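(* Let $k:\{n,n+1,\dots\}\to\mathbb R$. Let $\epsilon>0$, $\alpha>0$ and let $\xi_t=\frac{\alpha^2n^{1/2}}{162\log(Nn)}\epsilon t^{1/2}$ be the noise function of $\mathrm{PMWG}(X,F,\epsilon,0,\alpha,n)$. For every database stream $X$ and every (adaptively chosen) query stream $F$ with $\sum_{\tau=n}^t\ell_\tau\le\sum_{\tau=n}^tk_\tau$ for all $t\ge n$, $\mathrm{PMWG}(X,F,\epsilon,0,\alpha,n)$ answers every query $f_{t,j}$ with an answer $a_{t,j}$ satisfying $|f_{t,j}(x_t)-a_{t,j}|\le\alpha$, except with probability at most $$\exp\!\Big(-\frac{\alpha\xi_n}{24}\Big)+3\sum_{t\ge n}k_t\exp\!\Big(-\frac{\alpha\xi_t}{24}\Big).$$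
   Context: Data universe $[N]$. A database of size $t$ is a histogram $x\in\Delta([N])\subseteq\mathbb R^N$ with $x^i=n_i/t$, $n_i\in\mathbb N$, $\sum_i n_i=t$. A linear query is $f\in[0,1]^N$ with $f(x)=\langle f,x\rangle$. A database stream $X=\{x_t\}_{t\ge n}$ has $x_t$ of size $t$, $x_{t+1}$ obtained from $x_t$ by adding one entry. A query stream $F=\{\{f_{t,j}\}_{j=1}^{\ell_t}\}_{t\ge n}$ of linear queries, $f_{t,j}$ arriving when the database has size $t$, may be chosen adaptively. $\mathrm{Lap}(b)$ has density $\frac1{2b}e^{-|z|/b}$. Subroutines (threshold $T$, noise function $\xi$, on the database stream). NATG: when started it draws $\eta\sim\mathrm{Lap}(2)$; on each subsequent query $g$ arriving at time $t$ it draws fresh $\nu\sim\mathrm{Lap}(4/\xi_t)$; if $g(x_t)+\nu\ge T+\eta/\xi_t$ it outputs $g(x_t)+Z$, $Z\sim\mathrm{Lap}(8/\xi_t)$ fresh, and halts; otherwise outputs $\bot$. NSG: processes queries in order; whenever a query arrives and no NATG instance is running, it starts a fresh NATG instance with the same $T,\xi$; it outputs the running instance's answer. $\mathrm{PMWG}(X,F,\epsilon,0,\alpha,n)$: run NSG with $T=2\alpha/3$ and noise $\xi_t=\frac{\alpha^2n^{1/2}}{162\log(Nn)}\epsilon t^{1/2}$. Maintain a public histogram $y$, initially $y^i=1/N$, and a hard-query count $H=0$; let $b_t=\frac{\log N}{t}+\frac{\log(t-1)}{t}+\log\frac{t}{t-1}$. On query $f=f_{t,j}$: (1) if the previous query arrived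 at time $t'<t$, set $y^i\leftarrow\frac{t'}{t}y^i+\frac{t-t'}{t}\cdot\frac1N$; (2) submit to NSG the queries $g_1(x)=f(x)-f(y)$ and $g_2(x)=f(y)-f(x)$, getting $a_1,a_2\in\mathbb R\cup\{\bot\}$; (3) if $a_1=a_2=\bot$, output $f(y)$; (4) otherwise set $H\leftarrow H+1$; if $H>\frac{36}{\alpha^2}(\log N+\sum_{\tau=n+1}^t b_\tau)$ halt with output $\bot$; else output $a=f(y)+a_1$ if $a_1\in\mathbb R$ and $a=f(y)-a_2$ otherwise; let $r=f$ if $a<f(y)$ and $r=1-f$ otherwise, and update $y^i\leftarrow y^i e^{-\alpha r^i/6}/\sum_{i'}y^{i'}e^{-\alpha r^{i'}/6}$. *)

(* Defs.v *)
From HB Require Import structures.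
From mathcomp Require Import all_boot all_order all_algebra.
From mathcomp Require Import all_classical all_reals all_analysis.

Set Implicit Arguments.
Unset Strict Implicit.
Unset Printing Implicit Defensive.

Import Order.TTheory GRing.Theory Num.Theory.
Import numFieldNormedType.Exports.

Local Open Scope classical_set_scope.
Local Open Scope ring_scope.

Definition vec (R : realType) (N : nat) : Type := 'I_N -> R.

Definition inner (R : realType) (N : nat) (f x : vec R N) : R :=
  \sum_(i < N) f i * x i.

Definition is_database (R : realType) (N t : nat) (x : vec R N) : Prop :=
  exists cnt : 'I_N -> nat,
    (\sum_(i < N) cnt i)%N = t /\ forall i, x i = (cnt i)%:R / t%:R.

Definition adds_entry (R : realType) (N t : nat) (x x' : vec R N) : Prop :=
  exists i0 : 'I_N,
    forall i, x' i = (t%:R * x i + (i == i0)%:R) / t.+1%:R.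

Definition database_stream (R : realType) (N n : nat) (X : nat -> vec R N) :
    Prop :=
  forall t, (n <= t)%N -> is_database t (X t) /\ adds_entry t (X t) (X t.+1).

Definition laplace_pdf (R : realType) (b z : R) : R :=
  (2 * b)^-1 * expR (- `|z| / b).

Definition laplace_law (R : realType) (d : measure_display)
    (Om : measurableType d) (P : probability Om R) (b : R)
    (V : {RV P >-> R}) : Prop :=
  forall A : set R, measurable A ->
    P (V @^-1` A) = (\int[lebesgue_measure]_(z in A) (laplace_pdf b z)%:E)%E.

Definition mutually_independent (R : realType) (d : measure_display)
    (Om : measurableType d) (P : probability Om R) (I : eqType)
    (G : I -> set (set Om)) : Prop :=
  forall (J : seq I) (A : I -> set Om),
    uniq J -> (forall i, i \in J -> G i (A i)) ->
    P (\bigcap_(i in [set` J]) A i) = (\prod_(i <- J) P (A i))%E.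

Definition sigma_of (d d' : measure_display) (Om : measurableType d)
    (T : measurableType d') (V : Om -> T) : set (set Om) :=
  preimage_set_system [set: Om] V measurable.

(** The random values available to one query of NSG: [eta] is used only when
    that query starts a new NATG instance, [zeta] only when it is answered by
    a number. *)
Record nsg_noise (R : realType) :=
  NsgNoise { eta : R; nu : R; zeta : R }.

(** [v] is the exact value of the query; [None] is the answer bottom. *)
Definition natg_answer (R : realType) (T xi_t eta nu zeta v : R) : option R :=
  if T + eta / xi_t <= v + nu then Some (v + zeta) else None.

(** The state of NSG is the [eta] of the running NATG instance, or [None] when
    no instance is running. Returns the answer and the new state. *)
Definition nsg_step (R : realType) (T xi_t : R) (st : option R)
    (w : nsg_noise R) (v : R) : option R * option R :=
  let e := if st is Some e0 then e0 else eta w in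
  let a := natg_answer T xi_t e (nu w) (zeta w) v in
  (a, if a is Some _ then None else Some e).

Definition xi (R : realType) (N n : nat) (eps alpha : R) (t : nat) : R :=
  alpha ^+ 2 * Num.sqrt n%:R / (162 * ln (N * n)%:R) * eps * Num.sqrt t%:R.

Definition growth_term (R : realType) (N t : nat) : R :=
  ln N%:R / t%:R + ln t.-1%:R / t%:R + ln (t%:R / t.-1%:R).

Definition hard_bound (R : realType) (N n : nat) (alpha : R) (t : nat) : R :=
  36 / alpha ^+ 2 *
    (ln N%:R + \sum_(n.+1 <= tau < t.+1) growth_term R N tau).

Record pmwg_state (R : realType) (N : nat) := PmwgState {
  public : vec R N;          (* y *)
  last_time : option nat;    (* arrival time of the previous query *)
  hard : nat;                (* H *)
  nsg : option R }.          (* state of the NSG subroutine *)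

Definition pmwg_init (R : realType) (N : nat) : pmwg_state R N :=
  {| public := fun=> N%:R^-1; last_time := None; hard := 0; nsg := None |}.

Definition public_growth (R : realType) (N : nat) (last : option nat)
    (t : nat) (y : vec R N) : vec R N :=
  if last is Some t' then
    if (t' < t)%N then
      fun i => t'%:R / t%:R * y i + (t - t')%:R / t%:R * N%:R^-1
    else y
  else y.

Definition mw_update (R : realType) (N : nat) (alpha : R) (r y : vec R N) :
    vec R N :=
  fun i => y i * expR (- (alpha * r i / 6)) /
           \sum_(i' < N) y i' * expR (- (alpha * r i' / 6)).

(** Treatment of the query [f] arriving when the database is [x], of size [t];
    [w false] and [w true] are the noises for g_1 and g_2. The answer is
    [None] when the mechanism halts. *)
Definition pmwg_step (R : realType) (N n : nat) (eps alpha : R)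
    (st : pmwg_state R N) (t : nat) (x f : vec R N) (w : bool -> nsg_noise R) :
    pmwg_state R N * option R :=
  let T := 2 * alpha / 3 in
  let xi_t := xi N n eps alpha t in
  let y := public_growth (last_time st) t (public st) in
  let: (a1, nsg1) :=
    nsg_step T xi_t (nsg st) (w false) (inner f x - inner f y) in
  let: (a2, nsg2) :=
    nsg_step T xi_t nsg1 (w true) (inner f y - inner f x) in
  let hard_query (a : R) :=
    let H := (hard st).+1 in
    let r := if a < inner f y then f else fun i => 1 - f i in
    (PmwgState (mw_update alpha r y) (Some t) H nsg2,
     if hard_bound N n alpha t < H%:R then None else Some a) in
  match a1, a2 with
  | None, None => (PmwgState y (Some t) (hard st) nsg2, Some (inner f y))
  | Some z, _ => hard_query (inner f y + z)
  | None, Some z => hard_query (inner f y - z)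
  end.

(** The next query is a measurable function of the answers already given (in
    order of arrival) and of the analyst's private randomness [s : S]. [more]
    tells whether there is a next query and [wait] is the number of entries
    added to the database between the previous query (or the start, at size
    [n]) and the next one; so the numbers l_t of queries may be adaptive too. *)
Record query_stream (R : realType) (N : nat) (dS : measure_display)
    (S : measurableType dS) := QueryStream {
  more : S -> seq R -> bool;
  wait : S -> seq R -> nat;
  query : S -> seq R -> vec R N;
  query_range : forall s h i, 0 <= query s h i <= 1;
  measurable_more : forall m,
    measurable_fun [set: S * m.-tuple R] (fun p => more p.1 p.2);
  measurable_wait : forall m,
    measurable_fun [set: S * m.-tuple R] (fun p => wait p.1 p.2);
  measurable_query : forall m i,
    measurable_fun [set: S * m.-tuple R] (fun p => query p.1 p.2 i) }.

Record config (R : realType) (N : nat) := Config {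
  now : nat;
  mech : pmwg_state R N;
  answers : seq R }.

Record round_data (R : realType) (N : nat) := RoundData {
  arrival : nat;
  asked : vec R N;
  answer : option R;
  next_mech : pmwg_state R N }.

(** [w t m c] is the noise for the m-th query of the stream if it arrives when
    the database has size [t]. *)
Definition play (R : realType) (N n : nat) (eps alpha : R)
    (X : nat -> vec R N) (dS : measure_display) (S : measurableType dS)
    (F : query_stream R N S) (s : S) (w : nat -> nat -> bool -> nsg_noise R)
    (m : nat) (c : config R N) : option (round_data R N) :=
  if more F s (answers c) then
    let t := (now c + wait F s (answers c))%N in
    let f := query F s (answers c) in
    let: (st, a) := pmwg_step n eps alpha (mech c) t (X t) f (w t m) in
    Some (RoundData t f a st)
  else None.

(** [None] once the stream is exhausted or the mechanism has halted. *)
Fixpoint before (R : realType) (N n : nat) (eps alpha : R)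
    (X : nat -> vec R N) (dS : measure_display) (S : measurableType dS)
    (F : query_stream R N S) (s : S) (w : nat -> nat -> bool -> nsg_noise R)
    (m : nat) : option (config R N) :=
  if m is m'.+1 then
    if before n eps alpha X F s w m' is Some c then
      if play n eps alpha X F s w m' c is Some rd then
        if answer rd is Some a then
          Some (Config (arrival rd) (next_mech rd) (rcons (answers c) a))
        else None
      else None
    else None
  else Some (Config n (pmwg_init R N) [::]).

(** The m-th query (counted from 0), if it is submitted. *)
Definition round (R : realType) (N n : nat) (eps alpha : R)
    (X : nat -> vec R N) (dS : measure_display) (S : measurableType dS)
    (F : query_stream R N S) (s : S) (w : nat -> nat -> bool -> nsg_noise R)
    (m : nat) : option (round_data R N) :=
  if before n eps alpha X F s w m is Some c then
    play n eps alpha X F s w m c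
  else None.

(** l_t, the number of queries arriving when the database has size [t]. *)
Definition ell (R : realType) (N n : nat) (eps alpha : R)
    (X : nat -> vec R N) (dS : measure_display) (S : measurableType dS)
    (F : query_stream R N S) (s : S) (w : nat -> nat -> bool -> nsg_noise R)
    (t : nat) : \bar R :=
  (\sum_(0 <= m <oo)
     (if round n eps alpha X F s w m is Some rd
      then (arrival rd == t)%:R else 0)%:E)%E.

Definition accurate (R : realType) (N : nat) (alpha : R) (X : nat -> vec R N)
    (rd : round_data R N) : Prop :=
  if answer rd is Some a then
    `|inner (asked rd) (X (arrival rd)) - a| <= alpha
  else False.

Definition all_accurate (R : realType) (N n : nat) (eps alpha : R)
    (X : nat -> vec R N) (dS : measure_display) (S : measurableType dS)
    (F : query_stream R N S) (s : S) (w : nat -> nat -> bool -> nsg_noise R) :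
    Prop :=
  forall m rd, round n eps alpha X F s w m = Some rd -> accurate alpha X rd.

Variant draw := Eta | Nu | Zeta.

Definition draw_code (k : draw) : option bool :=
  match k with Eta => None | Nu => Some false | Zeta => Some true end.
Definition draw_decode (c : option bool) : draw :=
  match c with None => Eta | Some false => Nu | Some true => Zeta end.
Lemma draw_codeK : cancel draw_code draw_decode. Proof. by case. Qed.
HB.instance Definition _ := Equality.copy draw (can_type draw_codeK).

Definition draw_scale (R : realType) (xi_t : R) (k : draw) : R :=
  match k with Eta => 2 | Nu => 4 / xi_t | Zeta => 8 / xi_t end.

(** [W k t m c]: draw of kind [k] for the m-th query if it arrives at size [t],
    and for g_1 ([c = false]) or g_2 ([c = true]). The index [None] is the
    private randomness of the analyst. *)
Definition sources (R : realType) (d dS : measure_display)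
    (Om : measurableType d) (P : probability Om R) (S : measurableType dS)
    (U : Om -> S) (W : draw -> nat -> nat -> bool -> {RV P >-> R})
    (i : option (draw * nat * nat * bool)) : set (set Om) :=
  if i is Some (k, t, m, c) then sigma_of (W k t m c : Om -> R)
  else sigma_of U.

Definition noise_of (R : realType) (d : measure_display)
    (Om : measurableType d) (P : probability Om R)
    (W : draw -> nat -> nat -> bool -> {RV P >-> R}) (omega : Om)
    (t m : nat) (c : bool) : nsg_noise R :=
  NsgNoise (W Eta t m c omega) (W Nu t m c omega) (W Zeta t m c omega).

(** Sum of the series of the [u t], [t >= n], in the extended reals. The lower
    limit gives a value also when the terms have varying signs and the partial
    sums do not converge; otherwise it is the usual sum ([series_fromE]). *)
Definition series_from (R : realType) (n : nat) (u : nat -> R) : \bar R :=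
  limn_einf (fun m => \sum_(n <= t < m) (u t)%:E)%E.

Lemma series_fromE (R : realType) (n : nat) (u : nat -> R) :
  cvgn (fun m => \sum_(n <= t < m) (u t)%:E)%E ->
  series_from n u = (\sum_(n <= t <oo) (u t)%:E)%E.
Proof. exact: is_cvg_limn_einfE. Qed.

(* Main.v *)
(** Write e_t = exp(- alpha xi_t / 24) and v for the exact error f(x) - f(y) of
    the public histogram on the current query. Call a round noisy when one of
    the following happens, the sign of v being known before any noise of the
    round is drawn: the test that agrees with the sign of v gets noise at least
    alpha / 4, the other test gets noise at least alpha / 2, the noise of the
    released answer is at least alpha / 3, or the fresh eta drawn after the round
    is at least alpha xi_t / 12. The Laplace tails of these are e_t^(3/2), e_t^3,
    e_t and e_t, whose sum is at most 3 e_t as soon as e_t <= 1/3; and if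
    e_t > 1/3 the bound 3 e_t is trivial. Only the first eta is not charged to an
    earlier round, hence the extra e_n.

    If no round is noisy, each answer is within alpha, and each hard query has
    |v| >= alpha / 3 with the correct sign, so that the cross entropy
    - sum_i x^i log y^i drops by at least alpha^2 / 36. That potential is log N
    for the uniform histogram, stays nonnegative, and grows by at most b_t when
    an entry arrives, so that the mechanism never halts.

    The noise of round m is independent of the sigma-algebra of the earlier
    rounds, so the failure probability is at most
    e_n + 3 E[sum_t l_t e_t], and summation by parts replaces l_t by k_t because
    e_t is nonincreasing. *)

Require Import Defs.
From mathcomp Require Import all_boot all_order all_algebra.
From mathcomp Require Import all_classical all_reals all_analysis.
From mathcomp Require Import measurable_realfun ring lra.

Set Implicit Arguments.
Unset Strict Implicit.
Unset Printing Implicit Defensive.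

Import Order.TTheory GRing.Theory Num.Theory.
Import numFieldNormedType.Exports.

Local Open Scope classical_set_scope.
Local Open Scope ring_scope.

(** * Histograms, multiplicative weights and the cross-entropy potential *)

(** Multiply by [expR z], which is at least [1 + z]: the right side becomes at least
    [1 + z ^+ 3]. *)
Lemma expRN_le (R : realType) (z : R) : 0 <= z -> expR (- z) <= 1 - z + z ^+ 2.
Proof.
move=> z0; rewrite expRN.
have h1 := expR_ge1Dx z; have h2 := expR_gt0 z.
rewrite -[leLHS]mul1r ler_pdivrMr//.
apply: (@le_trans _ _ ((1 - z + z ^+ 2) * (1 + z))); last first.
  by rewrite ler_wpM2l//; nra.
have -> : (1 - z + z ^+ 2) * (1 + z) = 1 + z ^+ 3 by ring.
by rewrite lerDl exprn_ge0.
Qed.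

Section vectors.
Variables (R : realType) (N : nat).
Implicit Types (x y f r : vec R N).

(** This is the relative entropy plus the entropy of [x]. It is linear in [x], hence easy to follow
    when an entry arrives, and takes no logarithm of a zero count. *)
Definition cross_entropy x y : R := - \sum_(i < N) x i * ln (y i).

(** Strict positivity keeps every [ln (y i)] away from the default value of [ln]. *)
Definition is_density y := (forall i, 0 < y i) /\ \sum_(i < N) y i = 1.

Lemma density_le1 y i : is_density y -> y i <= 1.
Proof.
move=> [y0 <-]; rewrite (bigD1 i)//= lerDl.
by apply: sumr_ge0 => j _; rewrite ltW.
Qed.

Lemma cross_entropy_ge0 x y :
  (forall i, 0 <= x i) -> is_density y -> 0 <= cross_entropy x y.
Proof.
move=> x0 dy; rewrite oppr_ge0; apply: sumr_le0 => i _.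
by rewrite mulr_ge0_le0// ln_le0// density_le1.
Qed.

Lemma uniform_density : (0 < N)%N -> is_density ((fun=> N%:R^-1) : vec R N).
Proof.
move=> N0; split=> [i|]; first by rewrite invr_gt0 ltr0n.
by rewrite sumr_const card_ord -[_ *+ N]mulr_natr mulVf// pnatr_eq0 -lt0n.
Qed.

Lemma cross_entropy_uniform x : (0 < N)%N -> \sum_(i < N) x i = 1 ->
  cross_entropy x (fun=> N%:R^-1) = ln N%:R.
Proof.
move=> N0 x1; rewrite /cross_entropy -mulr_suml x1 mul1r lnV ?opprK//.
by rewrite posrE ltr0n.
Qed.

Lemma database_ge0 t x : is_database t x -> forall i, 0 <= x i.
Proof. by move=> [cnt [_ xE]] i; rewrite xE divr_ge0. Qed.

Lemma database_sum t x : (0 < t)%N -> is_database t x -> \sum_(i < N) x i = 1.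
Proof.
move=> t0 [cnt [cE xE]]; rewrite (eq_bigr _ (fun i _ => xE i)) -mulr_suml.
by rewrite -natr_sum cE divff// pnatr_eq0 -lt0n.
Qed.

Lemma inner_compl f x : inner (fun i => 1 - f i) x = \sum_(i < N) x i - inner f x.
Proof. by rewrite /inner -sumrB; apply: eq_bigr => i _; rewrite mulrBl mul1r. Qed.

Lemma mw_update_density alpha r y :
  (0 < N)%N -> is_density y -> is_density (mw_update alpha r y).
Proof.
move=> N0 [y0 y1].
have Z0 : 0 < \sum_(i < N) y i * expR (- (alpha * r i / 6)).
  rewrite (bigD1 (Ordinal N0))//= ltr_pwDl ?mulr_gt0 ?expR_gt0//.
  by apply: sumr_ge0 => i _; rewrite mulr_ge0 ?expR_ge0 ?ltW.
split=> [i|]; first by rewrite /mw_update divr_gt0// mulr_gt0 ?expR_gt0.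
by rewrite /mw_update -mulr_suml divff// gt_eqF.
Qed.

(** With [Z] the normalizing sum, the update adds [alpha / 6 * inner r x + ln Z] to the potential,
    and [ln Z <= Z - 1 <= - alpha / 6 * inner r y + (alpha / 6) ^+ 2]. The gap [alpha / 3] turns
    this into a change of at most [- alpha ^+ 2 / 18 + alpha ^+ 2 / 36]. *)
Lemma mw_update_progress alpha x r y : (0 < N)%N -> 0 < alpha ->
  (forall i, 0 <= x i) -> \sum_(i < N) x i = 1 -> is_density y ->
  (forall i, 0 <= r i <= 1) -> alpha / 3 <= inner r y - inner r x ->
  cross_entropy x (mw_update alpha r y) <= cross_entropy x y - alpha ^+ 2 / 36.
Proof.
move=> N0 a0 x0 x1 dy r01 hr; have [y0 y1] := dy.
set Z := \sum_(i < N) y i * expR (- (alpha * r i / 6)).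
have Z0 : 0 < Z.
  rewrite /Z (bigD1 (Ordinal N0))//= ltr_pwDl ?mulr_gt0 ?expR_gt0//.
  by apply: sumr_ge0 => i _; rewrite mulr_ge0 ?expR_ge0 ?ltW.
have -> : cross_entropy x (mw_update alpha r y) =
    cross_entropy x y + alpha / 6 * inner r x + ln Z.
  rewrite /cross_entropy /mw_update -/Z.
  rewrite (eq_bigr (fun i => x i * ln (y i) - alpha / 6 * (r i * x i) -
                            x i * ln Z)); last first.
    move=> i _; rewrite ln_div ?posrE ?mulr_gt0 ?expR_gt0//.
    by rewrite lnM ?posrE ?expR_gt0// expRK; ring.
  by rewrite !sumrB -mulr_suml x1 -mulr_sumr -/(inner r x); ring.
have hZ : Z <= 1 - alpha / 6 * inner r y + (alpha / 6) ^+ 2.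
  have -> : 1 - alpha / 6 * inner r y + (alpha / 6) ^+ 2 =
      \sum_(i < N) (y i - alpha / 6 * (r i * y i) + (alpha / 6) ^+ 2 * y i).
    by rewrite big_split sumrB/= -!mulr_sumr y1 mulr1.
  apply: ler_sum => i _; have /andP[r0 r1] := r01 i.
  have z0 : 0 <= alpha * r i / 6 by rewrite divr_ge0// mulr_ge0// ltW.
  apply: (le_trans (ler_wpM2l (ltW (y0 i)) (expRN_le z0))).
  have yi := y0 i.
  have -> : y i - alpha / 6 * (r i * y i) + (alpha / 6) ^+ 2 * y i =
     y i * (1 - alpha * r i / 6 + (alpha / 6) ^+ 2) by ring.
  apply: ler_wpM2l; first exact: ltW.
  rewrite lerD2l mulrAC exprMn -[leRHS]mulr1.
  by apply: ler_wpM2l; rewrite ?sqr_ge0// expr_le1.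
have hln : ln Z <= Z - 1.
  have := @le_ln1Dx R (Z - 1); rewrite subrKC; apply.
  by rewrite ltrBrDr addNr.
have : alpha / 6 * (alpha / 3) <= alpha / 6 * (inner r y - inner r x).
  by rewrite ler_wpM2l// divr_ge0// ltW.
by rewrite mulrBr => h; nra.
Qed.

Definition grow t y : vec R N := fun i => (t%:R * y i + N%:R^-1) / t.+1%:R.

Lemma grow_density t y : (0 < N)%N -> is_density y -> is_density (grow t y).
Proof.
move=> N0 [y0 y1]; split=> [i|].
  by rewrite divr_gt0// ltr_wpDl ?mulr_ge0 ?(ltW (y0 i))// invr_gt0 ltr0n.
rewrite /grow -mulr_suml big_split/= -mulr_sumr y1 mulr1.
by rewrite (uniform_density N0).2 natr1 divff.
Qed.

(* The two lower bounds on the new histogram used here, [t y / (t+1)] for the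
   old entries and [1 / (N (t+1))] for the new one, are what produces the shape
   of [growth_term]. *)
Lemma cross_entropy_grow t x x' y : (0 < N)%N -> (0 < t)%N ->
  is_database t x -> adds_entry t x x' -> is_density y ->
  cross_entropy x' (grow t y) <= cross_entropy x y + growth_term R N t.+1.
Proof.
move=> N0 t0 dx [i0 x'E] dy; have [y0 y1] := dy.
have x0 := database_ge0 dx; have x1 := database_sum t0 dx.
have tR : (0 : R) < t%:R by rewrite ltr0n.
have NR : (0 : R) < N%:R by rewrite ltr0n.
have sR : (0 : R) < t.+1%:R by rewrite ltr0n.
have g0 := (grow_density t N0 dy).1.
have h1 i : ln (y i) + ln t%:R - ln t.+1%:R <= ln (grow t y i).
  rewrite -lnM ?posrE// -ln_div ?posrE ?mulr_gt0// ler_ln ?posrE ?g0 ?divr_gt0 ?mulr_gt0//.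
  by rewrite /grow ler_pM2r ?invr_gt0// mulrC lerDl invr_ge0 ltW.
have h2 : - ln N%:R - ln t.+1%:R <= ln (grow t y i0).
  rewrite -lnV ?posrE// -ln_div ?posrE ?invr_gt0// ler_ln ?posrE ?g0 ?divr_gt0 ?invr_gt0//.
  by rewrite /grow ler_pM2r ?invr_gt0// lerDr mulr_ge0 ?ltW ?y0.
have -> : cross_entropy x' (grow t y) =
    (t%:R * (- \sum_(i < N) x i * ln (grow t y i)) - ln (grow t y i0)) / t.+1%:R.
  rewrite /cross_entropy (eq_bigr (fun i => (t%:R * (x i * ln (grow t y i)) +
     (i == i0)%:R * ln (grow t y i)) / t.+1%:R)); last first.
    by move=> i _; rewrite x'E; ring.
  rewrite -mulr_suml big_split/= -mulr_sumr.
  rewrite [X in _ + X](bigD1 i0)//= eqxx mul1r [X in _ + (_ + X)]big1 ?addr0.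
    by ring.
  by move=> i /negPf->; rewrite mul0r.
have h3 : - \sum_(i < N) x i * ln (grow t y i) <=
    cross_entropy x y - ln t%:R + ln t.+1%:R.
  rewrite /cross_entropy -[leRHS]opprK lerN2 !opprD !opprK.
  have -> : \sum_(i < N) x i * ln (y i) + ln t%:R - ln t.+1%:R =
    \sum_(i < N) x i * (ln (y i) + ln t%:R - ln t.+1%:R).
    under [RHS]eq_bigr do rewrite mulrBr mulrDr.
    by rewrite sumrB big_split/= -!mulr_suml x1 !mul1r.
  by apply: ler_sum => i _; rewrite ler_wpM2l.
(* Once the denominator [t.+1] is cleared, what [h2] and [h4] give falls short of the goal by
   exactly [cross_entropy x y], so its sign closes the proof. *)
have ce0 := cross_entropy_ge0 x0 dy.
rewrite /growth_term /= [ln (t.+1%:R / t%:R)]ln_div ?posrE// ler_pdivrMr//.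
set L := - \sum_(i < N) _ in h3 *.
have h4 : t%:R * L <= t%:R * (cross_entropy x y - ln t%:R + ln t.+1%:R).
  by rewrite ler_wpM2l// ltW.
rewrite !mulrDl !divfK ?gt_eqF// -natr1 in h1 h2 h3 h4 *.
nra.
Qed.

Lemma growth_term_ge0 t : (0 < N)%N -> (1 < t)%N -> 0 <= growth_term R N t.
Proof.
move=> N0; case: t => [|[|t]]// _.
rewrite /growth_term/= !addr_ge0 ?divr_ge0 ?ln_ge0 ?ler1n//.
by rewrite ler_pdivlMr// mul1r ler_nat.
Qed.

(** Factors a jump over several arrivals into single ones: the weights of [y] telescope. This
    permits induction on the arrivals. *)
Lemma public_growth_Some t t' y : (0 < t)%N -> (t <= t')%N ->
  public_growth (Some t) t'.+1 y = grow t' (public_growth (Some t) t' y).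
Proof.
move=> t0 tt'; apply/funext => i; rewrite /public_growth /grow.
have t'0 : (t'%:R : R) != 0 by rewrite pnatr_eq0 -lt0n (leq_trans t0).
have s0 : (t'%:R + 1 : R) != 0 by rewrite natr1.
rewrite ltnS tt' natrB ?(leq_trans tt')// -natr1.
move: tt'; rewrite leq_eqVlt => /orP[/eqP tt'|tt'].
  rewrite -tt' in t'0 s0 *; rewrite ltnn.
  by move: N%:R^-1 => u; field; rewrite s0.
rewrite tt' natrB ?(ltnW tt')//.
by move: N%:R^-1 => u; field; rewrite s0 t'0.
Qed.

Lemma public_growth_density last t y : (0 < N)%N ->
  is_density y -> is_density (public_growth last t y).
Proof.
move=> N0 [y0 y1]; rewrite /public_growth.
case: last => [t'|//]; case: ifPn => [tt'|//].
have tR : (0 : R) < t%:R by rewrite ltr0n (leq_ltn_trans _ tt').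
split=> [i|].
  apply: ltr_wpDl; first by rewrite !mulr_ge0 ?invr_ge0 ?(ltW (y0 i)).
  by rewrite mulr_gt0 ?divr_gt0 ?invr_gt0 ?tR ?ltr0n ?subn_gt0.
rewrite big_split/= -!mulr_sumr y1 (uniform_density N0).2 !mulr1.
by rewrite -mulrDl -natrD subnKC ?(ltnW tt')// divff ?gt_eqF.
Qed.

Lemma cross_entropy_public_growth n (X : nat -> vec R N) t t' y :
  (0 < N)%N -> (0 < n)%N -> database_stream n X -> (n <= t <= t')%N ->
  is_density y ->
  cross_entropy (X t') (public_growth (Some t) t' y) <=
  cross_entropy (X t) y + \sum_(t.+1 <= tau < t'.+1) growth_term R N tau.
Proof.
move=> N0 n0 hX /andP[nt tt'] dy.
have t0 := leq_trans n0 nt.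
elim: t' tt' => [|t' IH]; first by rewrite leqNgt t0.
rewrite leq_eqVlt => /orP[/eqP<-|].
  by rewrite /public_growth ltnn big_geq// addr0.
rewrite ltnS => tt'; rewrite public_growth_Some//.
have [dX aX] := hX t' (leq_trans nt tt').
apply: le_trans (cross_entropy_grow N0 (leq_trans t0 tt') dX aX _) _.
  exact: public_growth_density.
by rewrite big_nat_recr//= [leRHS]addrA lerD2r IH.
Qed.

End vectors.

(** * One step of the mechanism under small noise *)

Section mechanism.
Variables (R : realType) (N n : nat) (eps alpha : R) (X : nat -> vec R N).
Hypotheses (hNn : (1 < N * n)%N) (heps : 0 < eps) (halpha : 0 < alpha).
Hypothesis hX : database_stream n X.
Implicit Types (f y : vec R N) (st : pmwg_state R N) (w : bool -> nsg_noise R).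

Local Notation xi_ t := (xi N n eps alpha t).

Lemma domain_gt0 : (0 < N)%N.
Proof. by move: hNn; case: N. Qed.

Lemma start_gt0 : (0 < n)%N.
Proof. by move: hNn; case: n => //; rewrite muln0. Qed.

(** [1 < N * n] is what makes the logarithm in the denominator positive. *)
Lemma xi_coef_gt0 :
  0 < alpha ^+ 2 * Num.sqrt n%:R / (162 * ln (N * n)%:R) * eps.
Proof.
rewrite mulr_gt0// divr_gt0 ?mulr_gt0 ?exprn_gt0 ?sqrtr_gt0 ?ltr0n ?start_gt0//.
by rewrite ln_gt0// ltr1n.
Qed.

Lemma xi_gt0 t : (0 < t)%N -> 0 < xi_ t.
Proof.
by move=> t0; rewrite mulr_gt0 ?xi_coef_gt0// sqrtr_gt0 ltr0n.
Qed.

Lemma xi_le t t' : (t <= t')%N -> xi_ t <= xi_ t'.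
Proof.
move=> tt'; apply: ler_wpM2l; first by rewrite ltW ?xi_coef_gt0.
by rewrite ler_wsqrtr// ler_nat.
Qed.

Definition error_term t : R := expR (- (alpha * xi_ t / 24)).

Lemma error_term_le t t' : (t <= t')%N -> error_term t' <= error_term t.
Proof.
move=> tt'; rewrite ler_expR lerN2 ler_pM2r ?invr_gt0// ler_pM2l//.
exact: xi_le.
Qed.

Definition small_eta t (e : R) := `|e| < alpha * xi_ t / 12.

(** A running NATG instance keeps its [eta] while the database grows; the threshold grows with [xi],
    so smallness at the time of the draw persists. *)
Lemma small_eta_le t t' e : (t <= t')%N -> small_eta t e -> small_eta t' e.
Proof.
move=> tt' /lt_le_trans; apply; rewrite ler_pM2r ?invr_gt0// ler_pM2l//.
exact: xi_le.
Qed.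

Lemma small_etaP t e : (0 < t)%N -> small_eta t e ->
  - (alpha / 12) < e / xi_ t < alpha / 12.
Proof.
move=> t0; rewrite /small_eta mulrAC -ltr_pdivrMr ?xi_gt0//.
rewrite -{1}(gtr0_norm (xi_gt0 t0)) -normrV ?unitfE ?gt_eqF ?xi_gt0//.
by rewrite -normrM ltr_norml.
Qed.

(** [neg] tells whether the public histogram overestimates the query, so
    [w neg] is the noise of the test that ought to fire. A test against the
    sign of the error fires only under much larger noise. *)
Definition small_noise t (neg : bool) w :=
  [/\ `|nu (w neg)| < alpha / 4, `|nu (w (~~ neg))| < alpha / 2,
      `|zeta (w neg)| < alpha / 3 & ~~ neg -> small_eta t (eta (w true))].

Definition overestimates st t f :=
  inner f (X t) < inner f (public_growth (last_time st) t (public st)).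

Definition potential_bound t : R :=
  ln N%:R + \sum_(n.+1 <= tau < t.+1) growth_term R N tau.

(** The third clause is the budget: every hard query has paid [alpha ^+ 2 / 36] out of
    [potential_bound t]. The disjunction separates a histogram current at size [t] from the initial
    one, which is uniform and therefore current at every size. *)
Definition valid_state t st :=
  [/\ is_density (public st),
      last_time st = Some t \/
        [/\ last_time st = None, public st = (fun=> N%:R^-1) & hard st = 0%N],
      (hard st)%:R * (alpha ^+ 2 / 36) + cross_entropy (X t) (public st)
        <= potential_bound t &
      forall e, nsg st = Some e -> small_eta t e].

Lemma potential_boundD t t' : (n <= t <= t')%N ->
  potential_bound t + \sum_(t.+1 <= tau < t'.+1) growth_term R N tau =
  potential_bound t'.
Proof.
move=> /andP[nt tt'].
by rewrite /potential_bound -addrA -big_cat_nat.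
Qed.

Lemma valid_state_init t : (n <= t)%N -> valid_state t (pmwg_init R N).
Proof.
move=> nt; split=> //=; first exact: uniform_density domain_gt0.
- by right.
- rewrite mul0r add0r cross_entropy_uniform ?domain_gt0//.
    rewrite lerDl big_nat_cond sumr_ge0// => tau /andP[/andP[ntau _] _].
    by rewrite growth_term_ge0 ?domain_gt0// (leq_ltn_trans start_gt0).
  exact: database_sum (leq_trans start_gt0 nt) (hX nt).1.
Qed.

Lemma valid_state_growth t t' st (y := public_growth (last_time st) t' (public st)) :
  (n <= t <= t')%N -> valid_state t st -> is_density y /\
  (hard st)%:R * (alpha ^+ 2 / 36) + cross_entropy (X t') y <= potential_bound t'.
Proof.
move=> ntt' [dy hl hp _]; split; first exact: public_growth_density domain_gt0 dy.
case: hl => [lE|[lE yE hE]]; rewrite /y lE.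
  have := cross_entropy_public_growth domain_gt0 start_gt0 hX ntt' dy.
  by rewrite -(potential_boundD ntt'); move: hp; lra.
have nt' : (n <= t')%N by case/andP: ntt' => /leq_trans; apply.
have [_ _ + _] := valid_state_init nt'.
by rewrite /= hE yE.
Qed.

(** In units of [alpha], the threshold is 2/3 up to an error below 1/12. The test of the right sign
    thus fires only if the error of the histogram exceeds 2/3 - 1/12 - 1/4 = 1/3, and stays silent
    only if it is below 2/3 + 1/12 + 1/4 = 1. The other test would need noise of at least 7/12, but
    has less than 1/2. The last clause holds because a firing first test lets the second one start
    an instance that keeps running. *)
Lemma pmwg_step_small_noise t0 t st f w : (n <= t0 <= t)%N ->
  valid_state t0 st -> (forall i, 0 <= f i <= 1) ->
  small_noise t (overestimates st t f) w ->
  (nsg st = None -> small_eta t (eta (w false))) ->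
  let: (st', a) := pmwg_step n eps alpha st t (X t) f w in
  [/\ valid_state t st',
      exists2 b, a = Some b & `|inner f (X t) - b| <= alpha &
      nsg st' = None -> overestimates st t f].
Proof.
move=> ntt hv f01 [hnu hnu' hz he] he0.
have [nt0 t0t] := andP ntt; have nt := leq_trans nt0 t0t.
have tgt0 := leq_trans start_gt0 nt.
have [dx _] := hX nt.
have x0 := database_ge0 dx; have x1 := database_sum tgt0 dx.
have [dy hp] := valid_state_growth ntt hv.
have [_ _ _ hnsg] := hv.
move: hnu hnu' hz he; rewrite /overestimates /pmwg_step.
set y := public_growth _ t _ in dy hp *.
set T := 2 * alpha / 3; set px := inner f (X t); set py := inner f y.
(* The progress of the update pays for the new hard query; since the potential left over is
   nonnegative, the counter stays within [hard_bound]. *)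
have hard_ok r : (forall i, 0 <= r i <= 1) ->
    alpha / 3 <= inner r y - inner r (X t) ->
    ((hard st).+1%:R * (alpha ^+ 2 / 36) +
       cross_entropy (X t) (mw_update alpha r y) <= potential_bound t) /\
    (hard_bound N n alpha t < (hard st).+1%:R) = false.
  move=> r01 hr.
  have hpr := mw_update_progress domain_gt0 halpha x0 x1 dy r01 hr.
  have ce0 := cross_entropy_ge0 x0 (mw_update_density alpha r domain_gt0 dy).
  have h1 : (hard st).+1%:R * (alpha ^+ 2 / 36) +
       cross_entropy (X t) (mw_update alpha r y) <= potential_bound t.
    by rewrite -natr1 mulrDl mul1r; move: hp hpr; lra.
  split=> //; apply/negbTE; rewrite -leNgt /hard_bound -/(potential_bound t).
  have a20 : 0 < alpha ^+ 2 / 36 by rewrite divr_gt0 ?exprn_gt0.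
  rewrite -(ler_pM2r a20).
  have -> : 36 / alpha ^+ 2 * potential_bound t * (alpha ^+ 2 / 36) =
      potential_bound t by field; rewrite gt_eqF.
  by move: h1 ce0; lra.
have f01' i : 0 <= 1 - f i <= 1 by have := f01 i; lra.
(* Both histograms have total mass 1, so complementing the query flips the sign of the gap. *)
have compl_gap : inner (fun i => 1 - f i) y - inner (fun i => 1 - f i) (X t)
    = px - py by rewrite !inner_compl x1 dy.2 /px /py; lra.
set e1 := if nsg st is Some e0 then e0 else eta (w false).
have e1s : small_eta t e1.
  rewrite /e1; case: (nsg st) hnsg he0 => [e|_ ->//].
  by move=> /(_ e erefl) + _; exact: small_eta_le.
have /andP[e1l e1u] := small_etaP tgt0 e1s.
rewrite /nsg_step -/e1 /natg_answer.
case: (ltP px py) => [neg|pos] /=.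
- rewrite !ltr_norml => /andP[n2l n2u] /andP[n1l n1u] /andP[zl zu] _.
  have -> : (T + e1 / xi_ t <= px - py + nu (w false)) = false.
    by apply/negbTE; rewrite -ltNge /T; lra.
  case: ifPn => [hit|] /=.
    have gap : alpha / 3 < py - px by move: hit; rewrite /T; lra.
    (* The released noise is below [alpha / 3], hence below the gap: the answer lies on the same
       side of [py] as [px], and the update takes the right direction. *)
    have -> : py - (py - px + zeta (w true)) < py by lra.
    have [h1 ->] := hard_ok f f01 (ltW gap).
    split=> //; last by exists (py - (py - px + zeta (w true))) => //; rewrite ler_norml; lra.
    split=> //=; [exact: mw_update_density domain_gt0 dy|by left].
  rewrite -ltNge => miss; split=> //.
    by split=> //=; [left|move=> e [<-]].
  by exists py => //; move: miss; rewrite /T ler_norml; lra.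
- rewrite !ltr_norml => /andP[n1l n1u] /andP[n2l n2u] /andP[zl zu] /(_ isT) e2s.
  have /andP[e2l e2u] := small_etaP tgt0 e2s.
  case: ifPn => [hit|] /=.
    have gap : alpha / 3 < px - py by move: hit; rewrite /T; lra.
    have -> : (T + eta (w true) / xi_ t <= py - px + nu (w true)) = false.
      by apply/negbTE; rewrite -ltNge /T; lra.
    have -> : (py + (px - py + zeta (w false)) < py) = false.
      by apply/negbTE; rewrite -leNgt; lra.
    have [|h1 ->] := hard_ok (fun i => 1 - f i) f01'.
      by rewrite compl_gap ltW.
    split=> //; last by exists (py + (px - py + zeta (w false))) => //; rewrite ler_norml; lra.
    split=> //=; [exact: mw_update_density domain_gt0 dy|by left|by move=> e [<-]].
  rewrite -ltNge => miss.
  have -> : (T + e1 / xi_ t <= py - px + nu (w true)) = false.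
    by apply/negbTE; rewrite -ltNge /T; lra.
  split=> //; first by split=> //=; [left|move=> e [<-]].
  by exists py => //; move: miss; rewrite /T ler_norml; lra.
Qed.

End mechanism.

(** * The whole interaction under small noise *)

Section interaction.
Variables (R : realType) (N n : nat) (eps alpha : R) (X : nat -> vec R N).
Variables (dS : measure_display) (S : measurableType dS).
Variables (F : query_stream R N S) (s : S).
Variable w : nat -> nat -> bool -> nsg_noise R.

Local Notation before_ m := (before n eps alpha X F s w m).

Definition next_time (c : config R N) : option nat :=
  if more F s (answers c) then Some (now c + wait F s (answers c))%N else None.

(** Read off the configuration before the round, so that it depends only on the noise of earlier
    rounds; [round_arrival] links it to [round]. *)
Definition arrival_time m : option nat := obind next_time (before_ m).

(** Also determined before the noise of round [m]; it is consulted only together with an arrival at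
    round [m] or later. *)
Definition overestimated m : bool :=
  if before_ m is Some c then
    overestimates X (mech c) (now c + wait F s (answers c))
      (query F s (answers c))
  else false.

Lemma before_now m c : before_ m.+1 = Some c -> arrival_time m = Some (now c).
Proof.
rewrite /arrival_time /=; case: (before_ m) => //= c0.
rewrite /play /next_time; case: (more _ _ _) => //.
by case: (pmwg_step _ _ _ _ _ _ _ _) => st [a|]//= [<-].
Qed.

Lemma before_now_ge m c : before_ m = Some c -> (n <= now c)%N.
Proof.
elim: m c => [|m IH] c; first by move=> [<-].
move=> /before_now; rewrite /arrival_time.
case E : (before_ m) => [c0|]//=; rewrite /next_time; case: ifP => // _ [<-].
exact: leq_trans (IH _ E) (leq_addr _ _).
Qed.

Lemma arrival_time_ge m t : arrival_time m = Some t -> (n <= t)%N.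
Proof.
rewrite /arrival_time; case E : (before_ m) => [c|]//=.
rewrite /next_time; case: ifP => // _ [<-].
exact: leq_trans (before_now_ge E) (leq_addr _ _).
Qed.

Lemma arrival_timeS m t : arrival_time m.+1 = Some t ->
  exists2 t', arrival_time m = Some t' & (t' <= t)%N.
Proof.
rewrite {1}/arrival_time; case E : (before_ m.+1) => [c|]//=.
rewrite /next_time; case: ifP => // _ [<-].
by exists (now c); rewrite ?(before_now E) ?leq_addr.
Qed.

Lemma round_arrival m :
  omap (@arrival R N) (round n eps alpha X F s w m) = arrival_time m.
Proof.
rewrite /round /arrival_time; case: (before_ m) => //= c.
rewrite /play /next_time; case: (more _ _ _) => //.
by case: (pmwg_step _ _ _ _ _ _ _ _).
Qed.

Lemma all_accurate_small_noise :
  (1 < N * n)%N -> 0 < eps -> 0 < alpha -> database_stream n X ->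
  (forall m t, arrival_time m = Some t ->
     small_noise N n eps alpha t (overestimated m) (w t m)) ->
  (forall t, arrival_time 0 = Some t ->
     small_eta N n eps alpha t (eta (w t 0 false))) ->
  (forall m t, overestimated m -> arrival_time m.+1 = Some t ->
     small_eta N n eps alpha t (eta (w t m.+1 false))) ->
  all_accurate n eps alpha X F s w.
Proof.
move=> hNn heps halpha hX hw heta0 hetaS.
(* The invariant also looks ahead: if no instance is running, the [eta] that the next query will
   draw must be small. The last clause of [pmwg_step_small_noise] says when this has to be supplied
   by [hetaS]. *)
pose ready m c := valid_state n eps alpha X (now c) (mech c) /\
  (nsg (mech c) = None -> forall t, arrival_time m = Some t ->
     small_eta N n eps alpha t (eta (w t m false))).
have step m c t : ready m c -> before_ m = Some c -> next_time c = Some t ->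
    let: (st, a) := pmwg_step n eps alpha (mech c) t (X t)
                      (query F s (answers c)) (w t m) in
    [/\ valid_state n eps alpha X t st,
        exists2 b, a = Some b & `|inner (query F s (answers c)) (X t) - b| <= alpha &
        nsg st = None -> overestimated m].
  move=> [hv he] bE tE.
  have aE : arrival_time m = Some t by rewrite /arrival_time bE.
  have oE : overestimated m = overestimates X (mech c) t (query F s (answers c)).
    rewrite /overestimated bE; move: tE; rewrite /next_time.
    by case: ifP => // _ [->].
  rewrite oE; apply: pmwg_step_small_noise hv _ _ _ => //.
  - apply/andP; split; first exact: before_now_ge bE.
    move: tE; rewrite /next_time; case: ifP => // _ [<-]; exact: leq_addr.
  - exact: query_range.
  - by rewrite -oE; exact: hw.
  - by move=> /he; exact.
have before_ready m c : before_ m = Some c -> ready m c.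
  elim: m c => [|m IH] c.
    by move=> [<-]; split=> [|_]//; exact: valid_state_init.
  move=> bS; have := bS; rewrite /=; case bE : (before_ m) => [c0|]//.
  have r0 := IH _ bE.
  rewrite /play; case mE : (more _ _ _) => //.
  have /(step _ _ _ r0 bE) :
      next_time c0 = Some (now c0 + wait F s (answers c0))%N.
    by rewrite /next_time mE.
  case: (pmwg_step _ _ _ _ _ _ _ _) => st a [hv [b -> _] ho] /= [cE].
  split=> [|h t]; first by rewrite -cE.
  by move: h; rewrite -cE => /ho/hetaS; apply.
move=> m rd; rewrite /round; case bE : (before_ m) => [c|]//.
rewrite /play; case mE : (more _ _ _) => //.
have /(step _ _ _ (before_ready _ _ bE) bE) :
    next_time c = Some (now c + wait F s (answers c))%N.
  by rewrite /next_time mE.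
by case: (pmwg_step _ _ _ _ _ _ _ _) => st a [_ [b -> hb] _] [<-].
Qed.

End interaction.

(** * Measurability by countable case distinction *)

Section discretely_measurable.
Variables (d : measure_display) (T : measurableType d).

(** For countable [I] this is measurability for the discrete sigma-algebra, stated without putting a
    measurable structure on options and tuples of discrete data. *)
Definition discretely_measurable (I : Type) (p : T -> I) :=
  forall i, measurable (p @^-1` [set i]).

Lemma measurable_cells (I : countType) (p : T -> I) (A : set T)
    (B : I -> set T) :
  discretely_measurable p -> (forall i, measurable (B i)) ->
  (forall x, A x <-> B (p x) x) -> measurable A.
Proof.
move=> mp mB AB.
have -> : A = \bigcup_i (p @^-1` [set i] `&` B i).
  apply/seteqP; split=> x /=; first by move=> /AB Bx; exists (p x).
  by move=> [i _ [/= <- /AB]].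
by apply: countable_bigcupT_measurable => // i; exact: measurableI.
Qed.

Lemma discretely_measurable_set (I : countType) (p : T -> I) (A : set I) :
  discretely_measurable p -> measurable (p @^-1` A).
Proof.
move=> mp; apply: (@measurable_cells _ p _ (fun i => [set _ | A i])) => // i.
have [Ai|nAi] := pselect (A i).
  by rewrite (_ : [set _ | _] = setT)//; apply/seteqP; split.
by rewrite (_ : [set _ | _] = set0)//; apply/seteqP; split.
Qed.

Lemma discretely_measurable_comp (I : countType) (J : Type) (p : T -> I)
    (g : I -> J) :
  discretely_measurable p -> discretely_measurable (fun x => g (p x)).
Proof.
by move=> mp j; apply: (@discretely_measurable_set _ p (g @^-1` [set j])).
Qed.

Lemma discretely_measurable_pair (I J : Type) (p : T -> I) (q : T -> J) :
  discretely_measurable p -> discretely_measurable q ->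
  discretely_measurable (fun x => (p x, q x)).
Proof.
move=> mp mq [i j].
rewrite (_ : _ @^-1` _ = p @^-1` [set i] `&` q @^-1` [set j]).
  exact: measurableI.
by apply/seteqP; split=> [x /= [-> ->]|x /= [-> ->]].
Qed.

Lemma discretely_measurable_bool (p : T -> bool) :
  measurable_fun setT p -> discretely_measurable p.
Proof. by move=> mp i; rewrite -[X in measurable X]setTI; exact: mp. Qed.

Lemma discretely_measurable_nat (p : T -> nat) :
  measurable_fun setT p -> discretely_measurable p.
Proof. by move=> mp i; rewrite -[X in measurable X]setTI; exact: mp. Qed.

(** Handles random indices: the noise and the database are looked up at a random size, constant on
    each cell of a countable partition. *)
Lemma measurable_fun_cells (d' : measure_display) (T' : measurableType d')
    (I : countType) (p : T -> I) (g : I -> T -> T') :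
  discretely_measurable p -> (forall i, measurable_fun setT (g i)) ->
  measurable_fun setT (fun x => g (p x) x).
Proof.
move=> mp mg _ A mA; rewrite setTI.
apply: (@measurable_cells _ p _ (fun i => g i @^-1` A)) => // i.
by rewrite -[X in measurable X]setTI; exact: mg.
Qed.

Lemma measurable_fun_discrete (d' : measure_display) (T' : measurableType d')
    (I : countType) (p : T -> I) (g : I -> T') :
  discretely_measurable p -> measurable_fun setT (fun x => g (p x)).
Proof.
by move=> mp; apply: (@measurable_fun_cells _ _ _ p (fun i _ => g i)).
Qed.

Variable R : realType.

Lemma measurable_funV (f : T -> R) :
  measurable_fun setT f -> measurable_fun setT (fun x => (f x)^-1).
Proof.
move=> mf.
(* A formula for the inverse that is correct at 0 as well. *)
rewrite (_ : (fun _ => _) = (fun x => f x * expR (- ln (f x ^+ 2)))).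
  apply: measurable_funM => //.
  apply: measurableT_comp; first exact: measurable_expR.
  apply: measurable_funN; apply: measurableT_comp; first exact: measurable_ln.
  exact: measurable_funX.
apply/funext => x; have [->|fx] := eqVneq (f x) 0; first by rewrite invr0 mul0r.
by rewrite expRN lnK ?posrE ?exprn_even_gt0// expr2 invfM mulrA divff// mul1r.
Qed.

Lemma measurable_inner (N : nat) (f g : 'I_N -> T -> R) :
  (forall i, measurable_fun setT (f i)) ->
  (forall i, measurable_fun setT (g i)) ->
  measurable_fun setT (fun x => inner (fun i => f i x) (fun i => g i x)).
Proof.
by move=> mf mg; apply: measurable_sum => i; exact: measurable_funM.
Qed.

Lemma measurable_mw_update (N : nat) alpha (r y : 'I_N -> T -> R) i :
  (forall i, measurable_fun setT (r i)) ->
  (forall i, measurable_fun setT (y i)) ->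
  measurable_fun setT
    (fun x => mw_update alpha (fun i => r i x) (fun i => y i x) i).
Proof.
move=> mr my.
have mf j : measurable_fun setT (fun x => y j x * expR (- (alpha * r j x / 6))).
  apply: measurable_funM => //.
  apply: measurableT_comp; first exact: measurable_expR.
  apply: measurable_funN; apply: measurable_funM; last exact: measurable_cst.
  by apply: measurable_funM => //; exact: measurable_cst.
apply: measurable_funM; first exact: mf.
by apply: measurable_funV; apply: measurable_sum => j; exact: mf.
Qed.

Lemma measurable_rcons m (h : T -> m.-tuple R) (a : T -> R) :
  measurable_fun setT h -> measurable_fun setT a ->
  measurable_fun setT (fun x => [the m.+1.-tuple R of rcons (h x) (a x)]).
Proof.
move=> mh ma; apply/measurable_fun_tnthP => i.
have [im|im] := ltnP i m.
  rewrite (_ : _ \o _ = fun x => tnth (h x) (Ordinal im)).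
    apply: (@measurableT_comp _ _ _ _ _ _ (fun x => tnth x (Ordinal im))) => //.
    exact: measurable_tnth.
  by apply/funext => x /=; rewrite !(tnth_nth 0)/= nth_rcons size_tuple im.
rewrite (_ : _ \o _ = a)//; apply/funext => x /=.
have -> : i = ord_max by apply/val_inj/eqP; rewrite eqn_leq -ltnS ltn_ord.
by rewrite (tnth_nth 0)/= nth_rcons size_tuple ltnn eqxx.
Qed.

End discretely_measurable.

(** * Measurability of the interaction *)

(** Replaces the nested matches by two booleans, so that each component of the result is a
    conditional between measurable expressions. *)
Lemma pmwg_stepE (R : realType) (N n : nat) (eps alpha : R)
    (st : pmwg_state R N) (t : nat) (x f : vec R N) (w : bool -> nsg_noise R) :
  pmwg_step n eps alpha st t x f w =
  let T := 2 * alpha / 3 in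
  let xi_t := xi N n eps alpha t in
  let y := public_growth (last_time st) t (public st) in
  let e1 := if nsg st is Some e0 then e0 else eta (w false) in
  let hit1 := T + e1 / xi_t <= inner f x - inner f y + nu (w false) in
  let e2 := if hit1 then eta (w true) else e1 in
  let hit2 := T + e2 / xi_t <= inner f y - inner f x + nu (w true) in
  let a := if hit1 then inner f y + (inner f x - inner f y + zeta (w false))
    else if hit2 then inner f y - (inner f y - inner f x + zeta (w true))
    else inner f y in
  let H := (hard st + (hit1 || hit2))%N in
  (PmwgState
     (if hit1 || hit2
      then mw_update alpha (if a < inner f y then f else fun i => 1 - f i) y
      else y) (Some t) H (if hit2 then None else Some e2),
   if (hit1 || hit2) && (hard_bound N n alpha t < H%:R) then None else Some a).
Proof.
rewrite /pmwg_step /nsg_step /natg_answer /=.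
by case: (nsg st) => [e0|]; case: (_ + _ <= _) => /=; case: (_ + _ <= _) => /=;
  rewrite ?addn0 ?addn1.
Qed.

Section measurable_play.
Variables (R : realType) (N n : nat) (eps alpha : R) (X : nat -> vec R N).
Variables (dS : measure_display) (S : measurableType dS).
Variable F : query_stream R N S.
Variables (d : measure_display) (T : measurableType d).
Variables (U : T -> S) (mU : measurable_fun setT U).
Variable W : draw -> nat -> nat -> bool -> T -> R.

(** Counterpart of [noise_of] for plain functions on an arbitrary measurable space, so that the same
    space can later carry the smaller sigma-algebra of the past. *)
Definition noise_at (x : T) t m c : nsg_noise R :=
  NsgNoise (W Eta t m c x) (W Nu t m c x) (W Zeta t m c x).

Local Notation before_ m x := (before n eps alpha X F (U x) (noise_at x) m).

Definition config_shape (c : config R N) : nat * option nat * nat * bool :=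
  (now c, last_time (mech c), hard (mech c), nsg (mech c) != None).

(** The discrete part of a random configuration is measurable, and on the event
    that it exists its real coordinates agree with measurable functions. *)
Definition config_coords m (C : T -> option (config R N))
    (y : 'I_N -> T -> R) (e : T -> R) (h : T -> m.-tuple R) :=
  [/\ discretely_measurable (fun x => omap config_shape (C x)),
      forall i, measurable_fun setT (y i), measurable_fun setT e,
      measurable_fun setT h &
      forall x c, C x = Some c ->
        [/\ public (mech c) = y ^~ x, forall e', nsg (mech c) = Some e' -> e' = e x &
            answers c = h x]].

Definition measurable_config m (C : T -> option (config R N)) :=
  exists y e (h : T -> m.-tuple R), config_coords C y e h.

Section turn.
Variables (m : nat) (C : T -> option (config R N)).
Variables (y : 'I_N -> T -> R) (e : T -> R) (h : T -> m.-tuple R).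
Hypothesis hC : config_coords C y e h.

Let mo x := more F (U x) (h x).
Let wa x := wait F (U x) (h x).
Let fq i x := query F (U x) (h x) i.

Let mUh : measurable_fun setT (fun x => (U x, h x)).
Proof. by have [_ _ _ mh _] := hC; exact: measurable_fun_pair. Qed.

Let mmo : discretely_measurable mo.
Proof.
apply: discretely_measurable_bool.
exact: (measurableT_comp (@measurable_more _ _ _ _ F m) mUh).
Qed.

Let mwa : discretely_measurable wa.
Proof.
apply: discretely_measurable_nat.
exact: (measurableT_comp (@measurable_wait _ _ _ _ F m) mUh).
Qed.

Lemma measurable_asked i : measurable_fun setT (fq i).
Proof. exact: (measurableT_comp (@measurable_query _ _ _ _ F m i) mUh). Qed.

Let shp x := (omap config_shape (C x), mo x, wa x).

Let mshp : discretely_measurable shp.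
Proof.
have [mD _ _ _ _] := hC.
by do 2 apply: discretely_measurable_pair => //.
Qed.

(** The defaults make these projections total; the resulting coordinates are compared with the
    mechanism only where the configuration exists. *)
Let shp_time (p : option (nat * option nat * nat * bool) * bool * nat) : nat :=
  if p is (Some (t, _, _, _), _, j) then (t + j)%N else 0%N.
Let shp_last (p : option (nat * option nat * nat * bool) * bool * nat) :=
  if p is (Some (_, l, _, _), _, _) then l else None.
Let shp_hard (p : option (nat * option nat * nat * bool) * bool * nat) :=
  if p is (Some (_, _, k, _), _, _) then k else 0%N.
Let shp_nsg (p : option (nat * option nat * nat * bool) * bool * nat) :=
  if p is (Some (_, _, _, b), _, _) then b else false.

Let tm x := shp_time (shp x).

Let grown i x := public_growth (shp_last (shp x)) (tm x) (y ^~ x) i.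

Let mgrown i : measurable_fun setT (grown i).
Proof.
have [_ my _ _ _] := hC.
apply: (@measurable_fun_cells _ _ _ _ _ shp
  (fun p x => public_growth (shp_last p) (shp_time p) (y ^~ x) i)) => // p.
rewrite /public_growth; case: (shp_last p) => // t'; case: (t' < _)%N => //.
by apply: measurable_funD => //; exact: measurable_funM.
Qed.

Definition asked_value x := inner (fq ^~ x) (X (tm x)).
Definition public_value x := inner (fq ^~ x) (grown ^~ x).

Lemma measurable_asked_value : measurable_fun setT asked_value.
Proof.
apply: measurable_inner => i; first exact: measurable_asked.
exact: (measurable_fun_discrete (fun p => X (shp_time p) i) mshp).
Qed.

Lemma measurable_public_value : measurable_fun setT public_value.
Proof. by apply: measurable_inner => i //; exact: measurable_asked. Qed.

Lemma asked_valueE x c : C x = Some c ->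
  asked_value x = inner (query F (U x) (answers c))
                    (X (now c + wait F (U x) (answers c))).
Proof.
move=> cE; have [_ _ _ _ /(_ _ _ cE)[_ _ ->]] := hC.
by rewrite /asked_value /tm /shp cE.
Qed.

Lemma public_valueE x c : C x = Some c ->
  public_value x = inner (query F (U x) (answers c))
    (public_growth (last_time (mech c)) (now c + wait F (U x) (answers c))
       (public (mech c))).
Proof.
move=> cE; have [_ _ _ _ /(_ _ _ cE)[-> _ ->]] := hC.
by rewrite /public_value /grown /tm /shp cE.
Qed.

Lemma measurable_next_time :
  discretely_measurable (fun x => obind (next_time F (U x)) (C x)).
Proof.
pose g (p : option (nat * option nat * nat * bool) * bool * nat) :=
  if p is (Some (t, _, _, _), true, j) then Some (t + j)%N else None.
rewrite (_ : (fun _ => _) = (fun x => g (shp x))).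
  exact: discretely_measurable_comp.
apply/funext => x.
have [_ _ _ _ /(_ x)] := hC; rewrite /shp; case: (C x) => //= c /(_ _ erefl).
by rewrite /next_time /g /mo /wa => -[_ _ ->]; case: (more _ _ _).
Qed.

Hypothesis mW : forall k t c, measurable_fun setT (W k t m c).

Let noise k c x := W k (tm x) m c x.

Let mnoise k c : measurable_fun setT (noise k c).
Proof.
exact: (@measurable_fun_cells _ _ _ _ _ shp (fun p => W k (shp_time p) m c)).
Qed.

Let thr : R := 2 * alpha / 3.
Let xit x := xi N n eps alpha (tm x).

Let mxit : measurable_fun setT xit.
Proof. exact: (measurable_fun_discrete (fun p => xi N n eps alpha (shp_time p)) mshp). Qed.

Let eta1 x := if shp_nsg (shp x) then e x else noise Eta false x.

Let meta1 : measurable_fun setT eta1.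
Proof.
have [_ _ me _ _] := hC.
apply: measurable_fun_ifT => //.
exact: (measurable_fun_discrete shp_nsg mshp).
Qed.

Let hits (g : T -> R) (et : T -> R) c x :=
  thr + et x / xit x <= g x + noise Nu c x.

Let mhits g et c : measurable_fun setT g -> measurable_fun setT et ->
  measurable_fun setT (hits g et c).
Proof.
move=> mg met; apply: measurable_fun_ler; last exact: measurable_funD.
apply: measurable_funD => //; apply: measurable_funM => //.
exact: measurable_funV.
Qed.

Let gap x := asked_value x - public_value x.
Let gap' x := public_value x - asked_value x.

Let mgap : measurable_fun setT gap.
Proof.
exact: measurable_funB measurable_asked_value measurable_public_value.
Qed.

Let mgap' : measurable_fun setT gap'.
Proof.
exact: measurable_funB measurable_public_value measurable_asked_value.
Qed.

Let hit1 := hits gap eta1 false.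
Let eta2 x := if hit1 x then noise Eta true x else eta1 x.
Let hit2 := hits gap' eta2 true.

Let mhit1 : measurable_fun setT hit1. Proof. exact: mhits. Qed.

Let meta2 : measurable_fun setT eta2.
Proof. exact: measurable_fun_ifT. Qed.

Let mhit2 : measurable_fun setT hit2. Proof. exact: mhits. Qed.

Let ans x :=
  if hit1 x then public_value x + (gap x + noise Zeta false x)
  else if hit2 x then public_value x - (gap' x + noise Zeta true x)
  else public_value x.

Let mans : measurable_fun setT ans.
Proof.
have mp := measurable_public_value.
apply: measurable_fun_ifT => //.
  by apply: measurable_funD => //; exact: measurable_funD.
apply: measurable_fun_ifT => //.
by apply: measurable_funB => //; exact: measurable_funD.
Qed.

Let upd i x := if ans x < public_value x then fq i x else 1 - fq i x.

Let mupd i : measurable_fun setT (upd i).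
Proof.
apply: measurable_fun_ifT; first exact: measurable_fun_ltr mans measurable_public_value.
  exact: measurable_asked.
by apply: measurable_funB => //; exact: measurable_asked.
Qed.

Let pub i x :=
  if hit1 x || hit2 x then mw_update alpha (upd ^~ x) (grown ^~ x) i
  else grown i x.

Let mpub i : measurable_fun setT (pub i).
Proof.
apply: measurable_fun_ifT => //; first exact: measurable_or.
exact: measurable_mw_update.
Qed.

Let full := fun x => (shp x, hit1 x, hit2 x).

Let mfull : discretely_measurable full.
Proof.
apply: discretely_measurable_pair; last exact: discretely_measurable_bool.
by apply: discretely_measurable_pair => //; exact: discretely_measurable_bool.
Qed.

Definition next_config x : option (config R N) :=
  if C x is Some c then
    if play n eps alpha X F (U x) (noise_at x) m c is Some rd then
      if answer rd is Some a then
        Some (Config (arrival rd) (next_mech rd) (rcons (answers c) a))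
      else None
    else None
  else None.

(** Every branch is decided by [shp], [hit1] and [hit2], and every real coordinate is a total
    measurable function. *)
Let next_configE x : next_config x =
  if shp x is (Some _, true, _) then
    let H := (shp_hard (shp x) + (hit1 x || hit2 x))%N in
    if (hit1 x || hit2 x) && (hard_bound N n alpha (tm x) < H%:R) then None
    else Some (Config (tm x)
      (PmwgState (pub ^~ x) (Some (tm x)) H (if hit2 x then None else Some (eta2 x)))
      (rcons (h x) (ans x)))
  else None.
Proof.
have [_ _ _ _ /(_ x)] := hC; rewrite /next_config.
case cE : (C x) => [c|]; last by rewrite /shp cE.
move=> /(_ _ erefl)[yE eE hE].
have tE : tm x = (now c + wait F (U x) (answers c))%N by rewrite /tm /shp cE hE.
have e1E : (if nsg (mech c) is Some e0 then e0 else noise Eta false x) = eta1 x.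
  rewrite /eta1 /shp cE /= /config_shape.
  by case: (nsg (mech c)) eE => //= e0 /(_ _ erefl).
have gE : public_growth (last_time (mech c)) (tm x) (public (mech c)) = grown ^~ x.
  by apply/funext => i; rewrite /grown /shp cE /= yE.
have shpE : shp x = (Some (config_shape c), more F (U x) (answers c), wait F (U x) (answers c)).
  by rewrite /shp cE hE.
have qE : query F (U x) (answers c) = fq ^~ x by rewrite hE.
rewrite shpE /play; case: (more _ _ _) => //.
rewrite -tE pmwg_stepE /= -/(noise Eta false x) -/(noise Nu false x).
rewrite -/(noise Zeta false x) -/(noise Eta true x) -/(noise Nu true x).
rewrite -/(noise Zeta true x) e1E gE qE -/(asked_value x) -/(public_value x).
rewrite -/thr -/(xit x) -/(gap x) -/(gap' x) -/(hits gap eta1 false x) -/(hit1 x).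
rewrite -/(eta2 x) -/(hits gap' eta2 true x) -/(hit2 x) -/(ans x) hE.
have -> : pub ^~ x = if hit1 x || hit2 x then
    mw_update alpha (if ans x < public_value x then fq ^~ x
                     else fun i => 1 - fq i x) (grown ^~ x) else grown ^~ x.
  apply/funext => i; rewrite /pub; case: ifP => // _.
  by rewrite /upd; case: ifP.
by case: ifP.
Qed.

Lemma measurable_next_config : measurable_config m.+1 next_config.
Proof.
exists pub, eta2, (fun x => [the m.+1.-tuple R of rcons (h x) (ans x)]).
have [_ _ _ mh _] := hC.
split=> //; [|exact: measurable_rcons|]; last first.
  move=> x c; rewrite next_configE.
  case: (shp x) => -[[q|] [|]] j //; cbv zeta; case: ifP => // _ [<-]; split=> //= e'.
  by case: ifP => // _ [].
pose g (p : option (nat * option nat * nat * bool) * bool * nat * bool * bool) :=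
  let: (q, h1, h2) := p in
  if q is (Some _, true, _) then
    let H := (shp_hard q + (h1 || h2))%N in
    if (h1 || h2) && (hard_bound N n alpha (shp_time q) < H%:R) then None
    else Some (shp_time q, Some (shp_time q), H, ~~ h2)
  else None.
rewrite (_ : (fun _ => _) = (fun x => g (full x))).
  exact: discretely_measurable_comp.
apply/funext => x; rewrite next_configE /g /full /tm.
case: (shp x) => -[[q|] [|]] j //; cbv zeta; case: ifP => // _.
by rewrite /config_shape /=; case: (hit2 x).
Qed.

End turn.

(** Measurability is asked only of the noise of rounds before [m]; this is what makes the
    configuration an event of the past of round [m]. *)
Lemma measurable_before m :
  (forall k t j c, (j < m)%N -> measurable_fun setT (W k t j c)) ->
  measurable_config m (fun x => before_ m x).
Proof.
elim: m => [_|m IH mW].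
  exists (fun _ _ => N%:R^-1), (fun=> 0), (fun=> [tuple]); split=> //.
    exact: (@discretely_measurable_comp _ _ _ _ (fun=> 0%N)
      (fun=> Some (n, None, 0%N, false))
      (discretely_measurable_nat (measurable_cst 0%N))).
  by move=> x c [<-].
have [|y [e [h hC]]] := IH; first by move=> k t j c /ltnW; exact: mW.
exact: (measurable_next_config hC (fun k t c => mW k t m c (ltnSn m))).
Qed.

Lemma measurable_arrival_time m :
  (forall k t j c, (j < m)%N -> measurable_fun setT (W k t j c)) ->
  discretely_measurable
    (fun x => arrival_time n eps alpha X F (U x) (noise_at x) m).
Proof.
move=> /measurable_before[y [e [h hC]]]; exact: measurable_next_time hC.
Qed.

Lemma measurable_overestimated m :
  (forall k t j c, (j < m)%N -> measurable_fun setT (W k t j c)) ->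
  discretely_measurable
    (fun x => overestimated n eps alpha X F (U x) (noise_at x) m).
Proof.
move=> /measurable_before[y [e [h hC]]].
pose lt x := asked_value (fun x => before_ m x) h x <
             public_value (fun x => before_ m x) y h x.
have mlt : discretely_measurable lt.
  apply: discretely_measurable_bool; apply: measurable_fun_ltr.
    exact: measurable_asked_value hC.
  exact: measurable_public_value hC.
have [mD _ _ _ _] := hC.
have := discretely_measurable_comp
  (fun p : option (nat * option nat * nat * bool) * bool => (p.1 != None) && p.2)
  (discretely_measurable_pair mD mlt).
rewrite (_ : (fun _ => _ && _) =
  (fun x => overestimated n eps alpha X F (U x) (noise_at x) m))//.
apply/funext => x; rewrite /overestimated.
case cE : (before_ m x) => [c|]//=.
by rewrite /lt (asked_valueE hC cE) (public_valueE hC cE).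
Qed.

(** The answer to round [m] is the last entry of the answers in configuration [m.+1]. If a query
    arrives and that configuration does not exist, the mechanism has halted. *)
Lemma measurable_not_all_accurate :
  (forall k t j c, measurable_fun setT (W k t j c)) ->
  measurable [set x | ~ all_accurate n eps alpha X F (U x) (noise_at x)].
Proof.
move=> mW.
rewrite (_ : [set _ | _] = \bigcup_m [set x | exists2 rd,
    round n eps alpha X F (U x) (noise_at x) m = Some rd &
    ~ accurate alpha X rd]); last first.
  apply/seteqP; split=> x /=.
    rewrite /all_accurate -existsNE => -[m /existsNP[rd /not_implyP[h1 h2]]].
    by exists m => //; exists rd.
  by move=> [m _ [rd h1 h2]] /(_ _ _ h1).
apply: bigcupT_measurable => m.
have [y [e [h hC]]] := measurable_before (fun k t j c (_ : (j < m)%N) => mW k t j c).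
have [y' [e' [h' [mD' _ _ mh' hC']]]] :=
  measurable_before (fun k t j c (_ : (j < m.+1)%N) => mW k t j c).
pose bad x := alpha < `|asked_value (fun x => before_ m x) h x - tnth (h' x) ord_max|.
have mbad : discretely_measurable bad.
  apply: discretely_measurable_bool; apply: measurable_fun_ltr => //.
  apply: measurableT_comp => //; apply: measurable_funB.
    exact: measurable_asked_value hC.
  apply: (@measurableT_comp _ _ _ _ _ _ (fun x => tnth x ord_max)) => //.
  exact: measurable_tnth.
have mA := measurable_next_time hC.
have := discretely_measurable_set
  [set p : option nat * option (nat * option nat * nat * bool) * bool | p.1.1 != None /\ (p.1.2 = None \/ p.2)]
  (discretely_measurable_pair (discretely_measurable_pair mA mD') mbad).
rewrite (_ : _ @^-1` _ = [set x | exists2 rd,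
    round n eps alpha X F (U x) (noise_at x) m = Some rd &
    ~ accurate alpha X rd])//.
apply/funext => x; apply/propext => /=.
rewrite /bad; have := hC' x; rewrite /round /=.
case cE : (before_ m x) => [c|] /=; last by split=> [[]//|[]].
rewrite (asked_valueE hC cE) /next_time /play.
case: (more _ _ _) => /=; last by split=> [[]//|[]].
case: (pmwg_step _ _ _ _ _ _ _ _) => st [a|] /= hE; last first.
  split=> _; last by split=> //; left.
  by eexists; first reflexivity.
have [_ _ aE] := hE _ erefl.
have -> : tnth (h' x) ord_max = a.
  have hsz : size (answers c) = m.
    by have [_ _ _ _ /(_ _ _ cE)[_ _ ->]] := hC; rewrite size_tuple.
  by rewrite (tnth_nth 0) -aE /= nth_rcons hsz ltnn eqxx.
split=> [[_ [//|lt]]|[rd [<-]]].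
  by eexists; first reflexivity; rewrite /accurate /=; apply/negP; rewrite -ltNge.
by rewrite /accurate /= => /negP; rewrite -ltNge => lt; split=> //; right.
Qed.

End measurable_play.

(** * Tails of the Laplace law *)

Section laplace_tail.
Variables (R : realType) (b : R).
Hypothesis b0 : 0 < b.

Local Notation mu := (@lebesgue_measure R).

Lemma continuous_laplace_pdf : continuous (@laplace_pdf R b).
Proof.
move=> z; apply: cvgM; first exact: cvg_cst.
apply: continuous_comp; last exact: continuous_expR.
apply: cvgM; last exact: cvg_cst.
by apply: cvgN; exact: norm_continuous.
Qed.

Lemma laplace_pdf_ge0 z : 0 <= laplace_pdf b z.
Proof.
by rewrite mulr_ge0 ?expR_ge0// invr_ge0 mulr_ge0// ltW.
Qed.

Lemma integral_laplace_pdf_right c : 0 <= c ->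
  (\int[mu]_(z in `[c, +oo[) (laplace_pdf b z)%:E = (expR (- c / b) / 2)%:E)%E.
Proof.
move=> c0.
(* An antiderivative of the density on the nonnegative half line, vanishing at infinity. *)
pose G x : R := - (expR (- x / b) / 2).
have dG (x : R) : is_derive x 1 G ((2 * b)^-1 * expR (- x / b)).
  rewrite /G; apply: is_derive_eq.
  by rewrite /GRing.scale /=; field; rewrite gt_eqF.
rewrite (@ge0_continuous_FTC2y _ _ G _ 0)//.
- by rewrite sub0e /G EFinN oppeK.
- by move=> x _; exact: laplace_pdf_ge0.
- by apply: continuous_subspaceT => x; exact: continuous_laplace_pdf.
- rewrite /G -oppr0; apply: cvgN; rewrite -[X in _ --> X](mul0r 2^-1).
  apply: cvgM; last exact: cvg_cst.
  rewrite (_ : (fun x => _) = (fun z => expR (- z)) \o (fun z => b^-1 * z)).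
    apply: (@cvg_comp _ _ _ _ _ _ (pinfty_nbhs R)); last exact: cvgr_expR.
    by apply: gt0_cvgMry => //; rewrite invr_gt0.
  by apply/funext => x /=; rewrite mulNr mulrC.
- apply/cvg_at_right_filter.
  apply: differentiable_continuous; apply/derivable1_diffP.
  by have [] := dG c.
- move=> x; rewrite in_itv/= andbT => cx; rewrite derive1E.
  have [_ ->] := dG x; rewrite /laplace_pdf ger0_norm//.
  exact: le_trans c0 (ltW cx).
Qed.

Lemma integral_laplace_pdf_left c : 0 <= c ->
  (\int[mu]_(z in `]-oo, (- c)%R]) (laplace_pdf b z)%:E = (expR (- c / b) / 2)%:E)%E.
Proof.
move=> c0; rewrite ge0_integration_by_substitutionNy//.
- rewrite -integral_laplace_pdf_right//; apply: eq_integral => z _ /=.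
  by rewrite /laplace_pdf normrN.
- by apply: continuous_subspaceT => x; exact: continuous_laplace_pdf.
- by move=> x _; exact: laplace_pdf_ge0.
Qed.

Lemma laplace_tail (d : measure_display) (Om : measurableType d)
    (P : probability Om R) (V : {RV P >-> R}) (c : R) :
  laplace_law b V -> 0 <= c ->
  (P [set x | (c <= `|V x|)%R] <= (expR (- c / b))%:E)%E.
Proof.
move=> hV c0.
have -> : [set x | c <= `|V x|] =
    V @^-1` `[c, +oo[ `|` V @^-1` `]-oo, (- c)%R].
  apply/seteqP; split=> x /=; rewrite !in_itv /= andbT.
    by rewrite ler_normr orbC lerNr => /orP[]; [right|left].
  by rewrite ler_normr [c <= - _]lerNr => -[->|->]//; rewrite orbT.
apply: (@le_trans _ _
    (P (V @^-1` `[c, +oo[) + P (V @^-1` `]-oo, (- c)%R]))%E).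
  by apply: measureU2; rewrite -[X in measurable X]setTI; exact: measurable_funP.
rewrite !hV//= integral_laplace_pdf_right// integral_laplace_pdf_left//.
by rewrite -EFinD lee_fin -splitr.
Qed.

End laplace_tail.

(** * Independence of one source from the events generated by others *)

Section independence.
Variables (R : realType) (d : measure_display) (Om : measurableType d).
Variables (P : probability Om R) (I : eqType) (G : I -> set (set Om)).
Hypothesis hind : mutually_independent P G.
Hypothesis Gm : forall i, G i `<=` measurable.
Hypothesis GT : forall i, G i setT.
Hypothesis GI : forall i, setI_closed (G i).

(** The pi-system that generates the joint sigma-algebra of the sources in [J0]. *)
Definition finite_meets (J0 : pred I) : set (set Om) :=
  [set A | exists J (B : I -> set Om),
     [/\ uniq J, forall i, i \in J -> J0 i /\ G i (B i) &
         A = \bigcap_(i in [set` J]) B i]].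

Lemma finite_meets_source (J0 : pred I) i A : J0 i -> G i A -> finite_meets J0 A.
Proof.
move=> Ji GA; exists [:: i], (fun=> A); split=> //.
  by move=> j; rewrite inE => /eqP ->.
apply/seteqP; split=> [x Ax j //|x /(_ i)]; apply; exact: mem_head.
Qed.

Lemma finite_meets_setI_closed J0 : setI_closed (finite_meets J0).
Proof.
move=> _ _ [J [B [uJ JB ->]]] [J' [B' [uJ' JB' ->]]].
(* An index on both lists gets the intersection of its two events; a missing one is padded with
   [setT]. *)
pose D i := (if i \in J then B i else setT) `&`
            (if i \in J' then B' i else setT).
exists (undup (J ++ J')), D; split; first exact: undup_uniq.
  move=> i; rewrite mem_undup mem_cat => iJ; split.
    by move: iJ => /orP[/JB[]|/JB'[]].
  by apply: GI; [case: ifP => // /JB[]|case: ifP => // /JB'[]].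
apply/seteqP; split=> x.
  move=> [h h'] i /= _; split.
    by case: ifP => // iJ; exact: h.
  by case: ifP => // iJ; exact: h'.
move=> h; split=> i /= iJ.
  by have := h i; rewrite /= mem_undup mem_cat iJ /D iJ => /(_ isT)[].
by have := h i; rewrite /= mem_undup mem_cat iJ orbT /D iJ => /(_ isT)[].
Qed.

Lemma finite_meets_measurable J0 A : <<s finite_meets J0 >> A -> measurable A.
Proof.
apply: smallest_sub; first exact: sigma_algebra_measurable.
move=> _ [J [B [uJ JB ->]]].
apply: fin_bigcap_measurable; first exact: finite_seq.
by move=> i /JB[_]; exact: Gm.
Qed.

(** A pi-lambda argument: for fixed [B], the events satisfying the product formula form a
    lambda-system, which contains the finite meets by mutual independence. *)
Lemma independent_of_meets (J0 : pred I) i A B : ~~ J0 i ->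
  <<s finite_meets J0 >> A -> G i B -> P (A `&` B) = (P A * P B)%E.
Proof.
move=> nJi sA GB; have mB := Gm GB.
have Bfin : P B \is a fin_num by exact: fin_num_measure.
suff: <<s finite_meets J0 >> `<=`
    [set A | measurable A /\ P (A `&` B) = (P A * P B)%E] by move=> /(_ _ sA)[].
apply: lambda_system_subset; first exact: finite_meets_setI_closed.
- apply/dynkin_lambda_system; split.
  + by split=> //; rewrite setTI probability_setT mul1e.
  + move=> C [mC hC]; split; first exact: measurableC.
    have -> : P (~` C `&` B) = (P B - P (C `&` B))%E.
      rewrite setIC -setDE measureD//; last by rewrite ltey_eq fin_num_measure.
      by rewrite setIC.
    by rewrite hC probability_setC// muleBl ?mul1e.
  + move=> C tC hC; have mC k : measurable (C k) by have [] := hC k.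
    split; first exact: bigcupT_measurable.
    rewrite setI_bigcupl measure_bigcup//=; last 2 first.
    * by move=> k _; exact: measurableI.
    * exact: trivIset_setIr.
    rewrite measure_bigcup//= muleC -(fineK Bfin) -nneseriesZl//.
    by apply: eq_eseriesr => k _; rewrite (hC k).2 muleC fineK.
- move=> _ [J [C [uJ JC ->]]]; split.
    apply: (@finite_meets_measurable J0); apply: sub_sigma_algebra.
    by exists J, C.
  have iJ : i \notin J by apply/negP => /JC[Ji _]; rewrite Ji in nJi.
  (* As [i] is outside [J], the event [B] can be placed at [i] and mutual independence applied to
     [i :: J]. *)
  pose C' j := if j == i then B else C j.
  have C'E j : j \in J -> C' j = C j.
    by move=> jJ; rewrite /C'; case: eqP => // ji; rewrite -ji jJ in iJ.
  have h1 := hind uJ (fun j jJ => (JC j jJ).2).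
  have /(hind (A := C')) : uniq (i :: J) by rewrite /= iJ.
  have -> : \bigcap_(j in [set` i :: J]) C' j = \bigcap_(j in [set` J]) C j `&` B.
    apply/seteqP; split=> x.
      move=> h; split.
        by move=> j /= jJ; rewrite -C'E//; apply: h; rewrite /= inE jJ orbT.
      by have := h i; rewrite /C' eqxx; apply; exact: mem_head.
    move=> [h hB] j /=; rewrite inE => /orP[/eqP->|jJ]; first by rewrite /C' eqxx.
    by rewrite C'E//; exact: h.
  move=> ->.
    rewrite big_cons {1}/C' eqxx muleC h1; congr (_ * _)%E.
    by apply: eq_big_seq => j jJ; rewrite C'E.
  move=> j; rewrite inE => /orP[/eqP->|jJ]; first by rewrite /C' eqxx.
  by rewrite C'E//; have [] := JC j jJ.
- by [].
Qed.

End independence.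

(** * Summation by parts, and bounds on measures and series *)

(** Only the partial sums of [l] and [k] are compared, so the terms cannot be. The partial sums of
    [k - l] are nonnegative, and a smaller weight on them only lowers the bound. *)
Lemma abel_le (R : realDomainType) (e k l : nat -> R) n M :
  (forall t t', (t <= t')%N -> e t' <= e t) -> (forall t, 0 <= e t) ->
  (forall t, (n <= t)%N ->
     \sum_(n <= tau < t.+1) l tau <= \sum_(n <= tau < t.+1) k tau) ->
  \sum_(n <= t < M) e t * l t <= \sum_(n <= t < M) e t * k t.
Proof.
move=> e_le e0 hlk; rewrite -subr_ge0 -sumrB.
case: M => [|M]; first by rewrite big_geq.
have gap_ge0 t : 0 <= \sum_(n <= tau < t.+1) (k tau - l tau).
  have [nt|nt] := leqP n t; first by rewrite sumrB subr_ge0 hlk.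
  by rewrite big_geq.
(* Strengthened for the induction: the weighted sum dominates the last weight times the unweighted
   sum. *)
suff : e M * \sum_(n <= t < M.+1) (k t - l t) <=
    \sum_(n <= t < M.+1) (e t * k t - e t * l t).
  by apply: le_trans; rewrite mulr_ge0.
elim: M => [|M IH].
  by case: n {hlk gap_ge0} => [|n]; rewrite ?big_nat1 ?mulrBr// !big_geq// mulr0.
have [nM|nM] := leqP n M.+1; last by rewrite !big_geq// mulr0.
rewrite big_nat_recr//= [in leRHS]big_nat_recr//= mulrDr -mulrBr lerD2r; apply: le_trans IH.
by rewrite ler_wpM2r// e_le.
Qed.

Section measure_bounds.
Local Open Scope ereal_scope.
Variables (R : realType) (d : measure_display) (Om : measurableType d).
Variable P : probability Om R.

(** The cells [C t] are disjoint parts of [A], so the individual charges add up to one charge on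
    [A]. *)
Lemma measure_bigcup_charge (C D : nat -> set Om) (A : set Om) (e : R) :
  (0 <= e)%R -> measurable A -> (forall t, measurable (C t)) ->
  (forall t, measurable (D t)) -> trivIset setT C ->
  (forall t, C t `<=` A) -> (forall t, P (C t `&` D t) <= e%:E * P (C t)) ->
  P (\bigcup_t (C t `&` D t)) <= e%:E * P A.
Proof.
move=> e0 mA mC mD tC CA hP.
have mCD t : measurable (C t `&` D t) by exact: measurableI.
apply: (@le_trans _ _ (\sum_(0 <= t <oo) P (C t `&` D t))).
  by apply: measure_sigma_subadditive => //; exact: bigcupT_measurable.
apply: (@le_trans _ _ (\sum_(0 <= t <oo) e%:E * P (C t))).
  by apply: lee_nneseries => t _ //; rewrite ?measure_ge0.
rewrite nneseriesZl//; apply: lee_wpmul2l; first by rewrite lee_fin.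
rewrite -[leLHS]measure_semi_bigcup//; last exact: bigcupT_measurable.
apply: le_measure; rewrite ?inE//; first exact: bigcupT_measurable.
by move=> x [t _ /CA].
Qed.

(** The partial sum of [a] up to [M] lies below every [u M'] with [M <= M'], hence below the infimum
    of that tail; [u] may diverge. *)
Lemma nneseries_le_limn_einf (a : (\bar R)^nat) (u : (\bar R)^nat) :
  (forall t, 0 <= a t) -> (forall M, \sum_(0 <= t < M) a t <= u M) ->
  \sum_(0 <= t <oo) a t <= limn_einf u.
Proof.
move=> a0 au; rewrite limn_einf_lim; apply: lee_lim.
- exact: is_cvg_nneseries.
- exact: is_cvg_einfs.
apply: nearW => M; apply/ereal_infP => _ [M' /= MM' <-].
apply: le_trans (au M'); exact: lee_sum_nneg_natr.
Qed.

End measure_bounds.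

(** * The probability that a round is bad *)

Section accuracy.
Variables (R : realType) (N n : nat) (eps alpha : R) (X : nat -> vec R N).
Hypotheses (hNn : (1 < N * n)%N) (heps : 0 < eps) (halpha : 0 < alpha).
Hypothesis hX : database_stream n X.
Variables (dS : measure_display) (S : measurableType dS).
Variable F : query_stream R N S.
Variables (d : measure_display) (Om : measurableType d) (P : probability Om R).
Variables (U : Om -> S) (hU : measurable_fun [set: Om] U).
Variable W : draw -> nat -> nat -> bool -> {RV P >-> R}.
Hypothesis hlaw : forall (q : draw) (t m : nat) (c : bool), (n <= t)%N ->
  laplace_law (draw_scale (xi N n eps alpha t) q) (W q t m c).
Hypothesis hind : mutually_independent P (sources U W).

Local Notation xi_ t := (xi N n eps alpha t).
Local Notation err t := (error_term N n eps alpha t).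
Local Notation arr m := (fun x => arrival_time n eps alpha X F (U x) (noise_of W x) m).
Local Notation over m := (fun x => overestimated n eps alpha X F (U x) (noise_of W x) m).

Lemma sourcesT i : sources U W i setT.
Proof.
by case: i => [[[[k t] m] c]|]; exists setT => //; rewrite setTI preimage_setT.
Qed.

Lemma sourcesI i : setI_closed (sources U W i).
Proof.
case: i => [[[[k t] m] c]|] _ _ [A mA <-] [B mB <-];
  by exists (A `&` B); [exact: measurableI|rewrite !setTI preimage_setI].
Qed.

Lemma sources_measurable i : sources U W i `<=` measurable.
Proof.
case: i => [[[[k t] m] c]|] _ [A mA <-]; last exact: hU.
exact: measurable_funP.
Qed.

(** The private randomness of the analyst always belongs to the past, as does the noise of every
    earlier round at all possible sizes. *)
Definition past m (i : option (draw * nat * nat * bool)) : bool :=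
  if i is Some (_, _, j, _) then (j < m)%N else true.

Local Notation history m := (finite_meets (sources U W) (past m)).

Lemma measurable_history m A : <<s history m >> A -> measurable A.
Proof. exact: finite_meets_measurable sources_measurable _ _. Qed.

Let mU_history m : measurable_fun [set: g_sigma_algebraType (history m)] U.
Proof.
move=> _ B mB; apply: sub_sigma_algebra.
by apply: (@finite_meets_source _ _ _ _ _ None) => //; exists B.
Qed.

Let mW_history m k t j c : (j < m)%N ->
  measurable_fun [set: g_sigma_algebraType (history m)] (W k t j c).
Proof.
move=> jm _ B mB; apply: sub_sigma_algebra.
by apply: (@finite_meets_source _ _ _ _ _ (Some (k, t, j, c))) => //; exists B.
Qed.

(** The measurability results are instantiated on [Om] with the sigma-algebra of the past. A later
    [M] is allowed because a round may be charged for an [eta] of the next one. *)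
Lemma arrival_history m M : (m <= M)%N ->
  @discretely_measurable _ (g_sigma_algebraType (history M)) _ (arr m).
Proof.
move=> mM; apply (@measurable_arrival_time R N n eps alpha X dS S F _
  (g_sigma_algebraType (history M)) U (@mU_history M) (fun k t j c => W k t j c) m).
by move=> k t j c jm; apply: mW_history; exact: leq_trans jm mM.
Qed.

Lemma overestimated_history m M : (m <= M)%N ->
  @discretely_measurable _ (g_sigma_algebraType (history M)) _ (over m).
Proof.
move=> mM; apply (@measurable_overestimated R N n eps alpha X dS S F _
  (g_sigma_algebraType (history M)) U (@mU_history M) (fun k t j c => W k t j c) m).
by move=> k t j c jm; apply: mW_history; exact: leq_trans jm mM.
Qed.

(** The sign is fixed along with the size because it selects which noise variables are tested. *)
Definition asks t m b := [set x | arr m x = Some t /\ over m x = b].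

Lemma asks_history t m b M : (m <= M)%N -> <<s history M >> (asks t m b).
Proof.
move=> mM; have := discretely_measurable_pair (arrival_history mM)
  (overestimated_history mM) (Some t, b).
by congr measurable; rewrite /asks; apply/seteqP; split=> x /= [-> ->].
Qed.

Definition large q t m c (th : R) := [set x | th <= `|W q t m c x|].

Lemma large_source q t m c th : sources U W (Some (q, t, m, c)) (large q t m c th).
Proof.
exists [set z : R | th <= `|z|]; last by rewrite setTI.
rewrite -[X in measurable X]setTI.
have : measurable_fun [set: R] (fun z : R => th <= `|z|).
  by apply: measurable_fun_ler => //; exact: measurableT_comp.
by move=> /(_ measurableT [set true]); apply.
Qed.

Lemma measurable_large q t m c th : measurable (large q t m c th).
Proof. exact: sources_measurable (large_source q t m c th). Qed.

Lemma draw_scale_gt0 q t : (n <= t)%N -> 0 < draw_scale (xi_ t) q.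
Proof.
move=> nt; have x0 : 0 < xi_ t.
  by rewrite xi_gt0// (leq_trans (start_gt0 hNn)).
by case: q => //=; rewrite divr_gt0.
Qed.

Lemma large_noise_charge A q t m c (th e : R) :
  (n <= t)%N -> 0 <= th -> <<s history m >> A ->
  expR (- th / draw_scale (xi_ t) q) <= e ->
  (P (A `&` large q t m c th) <= e%:E * P A)%E.
Proof.
move=> nt th0 hA he.
have -> : P (A `&` large q t m c th) = (P A * P (large q t m c th))%E.
  apply: (independent_of_meets hind sources_measurable sourcesT sourcesI _ hA
    (large_source q t m c th)).
  by rewrite /past ltnn.
rewrite muleC; apply: lee_wpmul2r => //.
apply: le_trans (laplace_tail (draw_scale_gt0 q nt) (hlaw q m c nt) th0) _.
by rewrite lee_fin.
Qed.

Definition arrives t m := [set x | arr m x = Some t].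

Lemma arrives_history t m M : (m <= M)%N -> <<s history M >> (arrives t m).
Proof. by move=> mM; exact: (arrival_history mM (Some t)). Qed.

Lemma measurable_asks t m b : measurable (asks t m b).
Proof. exact: measurable_history (asks_history t b (leqnn m)). Qed.

Lemma measurable_arrives t m : measurable (arrives t m).
Proof. exact: measurable_history (arrives_history t (leqnn m)). Qed.

Lemma trivIset_arrives m : trivIset setT (arrives ^~ m).
Proof.
by move=> t t' _ _ [x [/=]]; rewrite /arrives /= => -> [].
Qed.

Lemma measure_arrives t m :
  (P (arrives t m) = P (asks t m false) + P (asks t m true))%E.
Proof.
rewrite -[RHS]measureU; [|exact: measurable_asks|exact: measurable_asks|].
  congr (P _); apply/seteqP; split=> x; last by move=> [[]|[]].
  by rewrite /asks /=; case: overestimated; [right|left].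
by apply/seteqP; split=> // x [[_ /= h1] [_ /=]]; rewrite h1.
Qed.

(** The scale 2 halves the exponent to that of [err t']; monotonicity then charges the draw at the
    earlier size [t]. *)
Lemma eta_tail t t' : (t <= t')%N ->
  expR (- (alpha * xi_ t' / 12) / draw_scale (xi_ t') Eta) <= err t.
Proof.
move=> tt'; apply: le_trans (error_term_le hNn heps halpha tt').
by rewrite ler_expR /=; lra.
Qed.

Lemma eta_threshold_ge0 t : 0 <= alpha * xi_ t / 12.
Proof.
apply: divr_ge0 => //; apply: mulr_ge0; first exact: ltW.
by rewrite mulr_ge0 ?sqrtr_ge0// ltW// xi_coef_gt0.
Qed.

Definition eta_large t m := large Eta t m false (alpha * xi_ t / 12).

(** The size at which the [eta] is drawn is random but known from the past, so the event is split
    according to it. *)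
Lemma eta_charge A m t : <<s history m >> A ->
  (forall t' x, A x -> arr m x = Some t' -> (n <= t')%N /\ (t <= t')%N) ->
  (P (\bigcup_t' (A `&` arrives t' m `&` eta_large t' m))
     <= (err t)%:E * P A)%E.
Proof.
move=> hA A_le; apply: measure_bigcup_charge.
- exact: expR_ge0.
- exact: measurable_history hA.
- by move=> t'; apply: measurableI;
    [exact: measurable_history hA|exact: measurable_arrives].
- by move=> t'; exact: measurable_large.
- exact: trivIset_setIl (trivIset_arrives (m := m)).
- by move=> t' x [].
move=> t'; have [->|/set0P[x [Ax xt']]] := eqVneq (A `&` arrives t' m) set0.
  by rewrite set0I measure0 mule0.
have [nt' tt'] := A_le _ _ Ax xt'.
apply: large_noise_charge => //; first exact: eta_threshold_ge0.
  have := @measurableI _ (g_sigma_algebraType (history m)); apply.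
    exact: hA.
  exact: arrives_history.
exact: eta_tail.
Qed.

Definition eta_bad t m b :=
  if b then \bigcup_t' (asks t m true `&` arrives t' m.+1 `&` eta_large t' m.+1)
  else asks t m false `&` large Eta t m true (alpha * xi_ t / 12).

(* When the histogram overestimates the query, only the second test can fire
   and the fresh [eta] is drawn by the next query; otherwise the first one fires
   and the second test draws it at once. *)
Definition noisy t m b :=
  asks t m b `&` large Nu t m b (alpha / 4) `|`
  asks t m b `&` large Nu t m (~~ b) (alpha / 2) `|`
  asks t m b `&` large Zeta t m b (alpha / 3) `|` eta_bad t m b.

Lemma measurable_eta_bad t m b : measurable (eta_bad t m b).
Proof.
rewrite /eta_bad; case: b.
  apply: bigcupT_measurable => t'; apply: measurableI.
    by apply: measurableI; [exact: measurable_asks|exact: measurable_arrives].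
  exact: measurable_large.
by apply: measurableI; [exact: measurable_asks|exact: measurable_large].
Qed.

Lemma measurable_asks_large t m b q c th :
  measurable (asks t m b `&` large q t m c th).
Proof. by apply: measurableI; [exact: measurable_asks|exact: measurable_large]. Qed.

Lemma measurable_noisy t m b : measurable (noisy t m b).
Proof.
apply: measurableU; last exact: measurable_eta_bad.
by do 2 (apply: measurableU; last exact: measurable_asks_large);
  exact: measurable_asks_large.
Qed.

Lemma measure_noisy t m b : (n <= t)%N -> err t <= 3^-1 ->
  (P (noisy t m b) <= (3 * err t)%:E * P (asks t m b))%E.
Proof.
move=> nt e3; have x0 : 0 < xi_ t.
  by rewrite xi_gt0// (leq_trans (start_gt0 hNn)).
have e0 : 0 < err t by exact: expR_gt0.
(* [u] is the tail of the right-sign test, the power 3/2 of [err t]. With [err t <= 3^-1], the four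
   tails are at most 8/9, 1/9, 1 and 1 times [err t], in total 3. *)
pose u := expR (- (alpha * xi_ t / 16)).
have u2 : u ^+ 2 = err t ^+ 3.
  by rewrite -!expRM_natl; congr expR; lra.
have u0 : 0 < u by exact: expR_gt0.
have hu : u <= 8 / 9 * err t.
  have h8 : 0 <= 8 / 9 * err t by rewrite mulr_ge0// ltW.
  rewrite -(@ler_pXn2r _ 2) ?nnegrE ?(ltW u0)// u2 exprMn.
  rewrite exprSr [leRHS]mulrC; apply: ler_wpM2l; first exact: sqr_ge0.
  by apply: le_trans e3 _; lra.
have e9 : err t ^+ 3 <= 9^-1 * err t.
  have : err t ^+ 2 <= 9^-1 by nra.
  by move=> h; rewrite exprSr; apply: ler_wpM2r; first exact: ltW.
have hA := asks_history t b (leqnn m).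
have h1 : (P (asks t m b `&` large Nu t m b (alpha / 4)) <= u%:E * P (asks t m b))%E.
  apply: large_noise_charge => //; first by rewrite divr_ge0// ltW.
  by rewrite ler_expR /= le_eqVlt; apply/orP; left; apply/eqP; field; rewrite gt_eqF.
have h2 : (P (asks t m b `&` large Nu t m (~~ b) (alpha / 2)) <=
    (err t ^+ 3)%:E * P (asks t m b))%E.
  apply: large_noise_charge => //; first by rewrite divr_ge0// ltW.
  rewrite -expRM_natl ler_expR /= le_eqVlt.
  by apply/orP; left; apply/eqP; field; rewrite gt_eqF.
have h3 : (P (asks t m b `&` large Zeta t m b (alpha / 3)) <=
    (err t)%:E * P (asks t m b))%E.
  apply: large_noise_charge => //; first by rewrite divr_ge0// ltW.
  by rewrite ler_expR /= le_eqVlt; apply/orP; left; apply/eqP; field; rewrite gt_eqF.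
have h4 : (P (eta_bad t m b) <= (err t)%:E * P (asks t m b))%E.
  rewrite /eta_bad; case: b {h1 h2 h3} hA => hA.
    apply: eta_charge; first exact: asks_history (leqnSn m).
    move=> t' x [xt _] xt'; split; first exact: arrival_time_ge xt'.
    by have [t1] := arrival_timeS xt'; rewrite xt => -[->].
  apply: large_noise_charge => //; first exact: eta_threshold_ge0.
  exact: eta_tail.
apply: (@le_trans _ _ (u%:E * P (asks t m b) + (err t ^+ 3)%:E * P (asks t m b) +
    (err t)%:E * P (asks t m b) + (err t)%:E * P (asks t m b))%E).
  have mal := measurable_asks_large t m b.
  have m2 : measurable (asks t m b `&` large Nu t m b (alpha / 4) `|`
      asks t m b `&` large Nu t m (~~ b) (alpha / 2)) by exact: measurableU.
  have m3 : measurable (asks t m b `&` large Nu t m b (alpha / 4) `|`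
      asks t m b `&` large Nu t m (~~ b) (alpha / 2) `|`
      asks t m b `&` large Zeta t m b (alpha / 3)) by exact: measurableU.
  apply: le_trans (measureU2 _ m3 (measurable_eta_bad t m b)) _.
  apply: leeD => //; apply: le_trans (measureU2 _ m2 (mal _ _ _)) _.
  apply: leeD => //; apply: le_trans (measureU2 _ (mal _ _ _) (mal _ _ _)) _.
  exact: leeD.
rewrite -(@fineK _ (P (asks t m b))) ?fin_num_measure//; last exact: measurable_asks.
rewrite -!EFinM -!EFinD lee_fin -!mulrDl; apply: ler_wpM2r; last by lra.
exact: fine_ge0.
Qed.

(* If the error term exceeds 1/3 the bound claimed for the round exceeds 1, so
   that the whole round may be given up. *)
Definition bad t m :=
  if 3^-1 < err t then arrives t m else noisy t m false `|` noisy t m true.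

Lemma measurable_bad t m : measurable (bad t m).
Proof.
rewrite /bad; case: ifP => _; first exact: measurable_arrives.
by apply: measurableU; exact: measurable_noisy.
Qed.

Lemma measure_bad t m : (n <= t)%N ->
  (P (bad t m) <= (3 * err t)%:E * P (arrives t m))%E.
Proof.
move=> nt; rewrite /bad; case: ltP => [e3|e3].
  by rewrite -[leLHS]mul1e; apply: lee_wpmul2r => //; rewrite lee_fin; lra.
apply: le_trans (measureU2 _ (measurable_noisy t m false) (measurable_noisy t m true)) _.
by rewrite measure_arrives ge0_muleDr// leeD// measure_noisy.
Qed.

(** The intersection with [setT] gives the form of [eta_charge]; the first query arrives at size [n]
    or later, which costs [err n]. *)
Definition bad_start := \bigcup_t (setT `&` arrives t 0 `&` eta_large t 0).

Lemma measurable_bad_start : measurable bad_start.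
Proof.
apply: bigcupT_measurable => t; rewrite setTI; apply: measurableI.
  exact: measurable_arrives.
exact: measurable_large.
Qed.

Lemma measure_bad_start : (P bad_start <= (err n)%:E)%E.
Proof.
rewrite -[leRHS]mule1 -(@probability_setT _ _ _ P); apply: eta_charge.
  exact: (@measurableT _ (g_sigma_algebraType (history 0))).
by move=> t x _ /arrival_time_ge.
Qed.

(** * Covering the failure event and counting the queries *)

Let failure :=
  [set x | ~ all_accurate n eps alpha X F (U x) (noise_of W x)].

Lemma measurable_failure : measurable failure.
Proof.
apply: (@measurable_not_all_accurate R N n eps alpha X dS S F _ Om U hU
  (fun k t j c => W k t j c)).
by move=> q t j c; exact: measurable_funP.
Qed.

Lemma failure_bad :
  failure `<=` bad_start `|` \bigcup_(t in [set t | (n <= t)%N]) \bigcup_m bad t m.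
Proof.
move=> x fx; apply: contrapT => nbad; apply: fx.
have nb t m : (n <= t)%N -> ~ bad t m x.
  by move=> nt h; apply: nbad; right; exists t => //; exists m.
pose ov m := overestimated n eps alpha X F (U x) (noise_of W x) m.
(* If [err t] exceeds 1/3 the arrival itself is bad, which contradicts [nb]; otherwise noisiness for
   the actual sign is excluded. *)
have nnoisy t m : arr m x = Some t -> ~ noisy t m (ov m) x.
  move=> xt; have := nb t m (arrival_time_ge xt); rewrite /bad; case: ifP => _; first by [].
  by move=> h h'; apply: h; move: h'; case: (ov m); [right|left].
apply: all_accurate_small_noise => //.
- move=> m t xt; have xb : asks t m (ov m) x by [].
  have sm q c th : (large q t m c th x -> noisy t m (ov m) x) ->
      `|W q t m c x| < th.
    by move=> h; rewrite ltNge; apply/negP => /h; exact: nnoisy.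
  split.
  + by apply: sm => h; left; left; left.
  + by apply: sm => h; left; left; right.
  + by apply: sm => h; left; right.
  + move=> /negbTE ob; apply: sm => h; right; rewrite /eta_bad [ov m]ob.
    by split=> //; rewrite -ob.
- move=> t xt; rewrite /small_eta ltNge; apply/negP => h.
  by apply: nbad; left; exists t.
- move=> m t' xb xt'; rewrite /small_eta ltNge; apply/negP => h.
  have [t xt _] := arrival_timeS xt'.
  apply: (nnoisy t m xt); right; rewrite [ov m]xb.
  by exists t'.
Qed.

Lemma ellE t x : ell n eps alpha X F (U x) (noise_of W x) t =
  (\sum_(0 <= m <oo) (\1_(arrives t m) x)%:E)%E.
Proof.
apply: eq_eseriesr => m _; congr EFin; rewrite indicE.
have := round_arrival n eps alpha X F (U x) (noise_of W x) m.
case: round => [rd|] /= rE; last by rewrite memNset// /arrives /= -rE.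
congr ((nat_of_bool _)%:R); apply/eqP/idP => [rt|].
  by rewrite inE /arrives /= -rE rt.
by rewrite inE /arrives /= -rE => -[].
Qed.

(** Nonnegative terms allow exchanging sum and integral, so the expected number of queries is the
    sum of the arrival probabilities. *)
Lemma integral_ell t :
  (\int[P]_x ell n eps alpha X F (U x) (noise_of W x) t =
   \sum_(0 <= m <oo) P (arrives t m))%E.
Proof.
under eq_integral do rewrite ellE.
rewrite integral_nneseries//.
- apply: eq_eseriesr => m _.
  by rewrite integral_indic ?setIT//; exact: measurable_arrives.
- move=> m; apply/measurable_EFinP; apply: measurable_indic.
  exact: measurable_arrives.
Qed.

Lemma measurable_ell t :
  measurable_fun setT (fun x => ell n eps alpha X F (U x) (noise_of W x) t).
Proof.
rewrite (_ : (fun _ => _) =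
    (fun x => \sum_(m <oo | m \in xpredT) (\1_(arrives t m) x)%:E)%E).
  apply: ge0_emeasurable_sum => // m _; apply/measurable_EFinP.
  by apply: measurable_indic; exact: measurable_arrives.
by apply/funext => x; rewrite ellE.
Qed.

Lemma ell_ge0 t x : (0 <= ell n eps alpha X F (U x) (noise_of W x) t)%E.
Proof. by rewrite ellE; apply: nneseries_ge0. Qed.

Lemma measure_bad_time t : (n <= t)%N ->
  (P (\bigcup_m bad t m) <= (3 * err t)%:E *
     \int[P]_x ell n eps alpha X F (U x) (noise_of W x) t)%E.
Proof.
move=> nt; rewrite integral_ell -nneseriesZl//.
apply: (@le_trans _ _ (\sum_(0 <= m <oo) P (bad t m))%E).
  apply: measure_sigma_subadditive => //; first exact: measurable_bad.
  by apply: bigcupT_measurable => m; exact: measurable_bad.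
by apply: lee_nneseries => m _ //; exact: measure_bad.
Qed.

(** * Replacing the numbers of queries by their bounds *)

Variable k : nat -> R.
Hypothesis hF : forall (omega : Om) (t : nat), (n <= t)%N ->
  (\sum_(n <= tau < t.+1)
      ell n eps alpha X F (U omega) (noise_of W omega) tau
    <= (\sum_(n <= tau < t.+1) k tau)%:E)%E.

(** A single term is at most the partial sum, which [hF] bounds by a real. Finiteness brings the
    extended reals within reach of [abel_le]. *)
Lemma ell_fin_num t x : (n <= t)%N ->
  ell n eps alpha X F (U x) (noise_of W x) t \is a fin_num.
Proof.
move=> nt; rewrite ge0_fin_numE ?ell_ge0//.
apply: le_lt_trans (ltry (\sum_(n <= tau < t.+1) k tau)).
apply: le_trans (hF x nt); rewrite big_nat_recr//= leeDr//.
by apply: sume_ge0 => tau _; exact: ell_ge0.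
Qed.

Lemma weighted_ell_le M x :
  (\sum_(n <= t < M) (err t)%:E * ell n eps alpha X F (U x) (noise_of W x) t <=
   (\sum_(n <= t < M) err t * k t)%:E)%E.
Proof.
pose l t := fine (ell n eps alpha X F (U x) (noise_of W x) t).
have lE t : (n <= t)%N -> ell n eps alpha X F (U x) (noise_of W x) t = (l t)%:E.
  by move=> nt; rewrite fineK// ell_fin_num.
rewrite (_ : (\sum_(n <= t < M) _)%E = (\sum_(n <= t < M) err t * l t)%:E).
  rewrite lee_fin; apply: abel_le.
  - by move=> t t'; exact: error_term_le.
  - by move=> t; exact: expR_ge0.
  move=> t nt; rewrite -lee_fin; apply: le_trans (hF x nt).
  rewrite -sumEFin big_nat_cond [leRHS]big_nat_cond le_eqVlt.
  apply/orP; left; apply/eqP; apply: eq_bigr => tau /andP[/andP[ntau _] _].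
  by rewrite lE.
rewrite -sumEFin big_nat_cond [RHS]big_nat_cond.
by apply: eq_bigr => t /andP[/andP[nt _] _]; rewrite lE.
Qed.

(** The pathwise bound [weighted_ell_le] is a constant, and [P] has mass 1. *)
Lemma integral_weighted_ell_le M :
  (\sum_(n <= t < M)
     (err t)%:E * \int[P]_x ell n eps alpha X F (U x) (noise_of W x) t <=
   (\sum_(n <= t < M) err t * k t)%:E)%E.
Proof.
have e0 t : (0 <= (err t)%:E)%E by rewrite lee_fin expR_ge0.
have intZ t : ((err t)%:E * \int[P]_x ell n eps alpha X F (U x) (noise_of W x) t =
    \int[P]_x ((err t)%:E * ell n eps alpha X F (U x) (noise_of W x) t))%E.
  rewrite ge0_integralZl//; first exact: measurable_ell.
  by move=> x _; exact: ell_ge0.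
under eq_bigr do rewrite intZ.
rewrite -ge0_integral_sum//; last 2 first.
- by move=> t; apply: measurable_funeM; exact: measurable_ell.
- by move=> t x _; rewrite mule_ge0 ?ell_ge0.
apply: (@le_trans _ _ (\int[P]_x (cst (\sum_(n <= t < M) err t * k t)%:E x))%E).
  apply: ge0_le_integral => //.
  - by move=> x _; apply: sume_ge0 => t _; rewrite mule_ge0 ?ell_ge0.
  - apply: emeasurable_sum => t; apply: measurable_funeM; exact: measurable_ell.
  - by move=> x _; exact: weighted_ell_le.
by rewrite integral_cst// [X in (_ * X)%E](@probability_setT _ _ _ P) mule1.
Qed.

Lemma measure_failure :
  (P failure <= (err n)%:E + 3%:E * series_from n (fun t => (k t * err t)%R))%E.
Proof.
have mV t : measurable (\bigcup_m bad t m).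
  by apply: bigcupT_measurable => m; exact: measurable_bad.
(* Sizes below [n] are filled with the empty set, so that the union becomes a series from 0. *)
pose V t := if t \in [set t | (n <= t)%N] then \bigcup_m bad t m else set0.
have mV' t : measurable (V t) by rewrite /V; case: ifP.
have mF := measurable_failure.
have mUV : measurable (\bigcup_t V t) by exact: bigcupT_measurable.
apply: (@le_trans _ _ (P (bad_start `|` \bigcup_t V t))).
  apply: le_measure; rewrite ?inE//.
    by apply: measurableU => //; exact: measurable_bad_start.
  by rewrite -bigcup_mkcond; exact: failure_bad.
apply: le_trans (measureU2 _ measurable_bad_start mUV) _.
apply: leeD; first exact: measure_bad_start.
pose a t : \bar R := if (n <= t)%N then
  ((err t)%:E * \int[P]_x ell n eps alpha X F (U x) (noise_of W x) t)%E else 0%E.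
have a0 t : (0 <= a t)%E.
  rewrite /a; case: ifP => // _; rewrite mule_ge0 ?lee_fin ?expR_ge0//.
  by apply: integral_ge0 => x _; exact: ell_ge0.
apply: (@le_trans _ _ (\sum_(0 <= t <oo) P (V t))%E).
  exact: measure_sigma_subadditive.
apply: (@le_trans _ _ (\sum_(0 <= t <oo) 3%:E * a t)%E).
  apply: lee_nneseries => t _ //; rewrite /V /a.
  have [nt|nt] := boolP (n <= t)%N.
    by rewrite mem_set// muleA -EFinM; exact: measure_bad_time.
  by rewrite memNset ?measure0 ?mule0//; exact/negP.
rewrite nneseriesZl//; apply: lee_wpmul2l => //.
(* The terms [k t] may vary in sign, so the comparison is made between partial sums and carried to
   the lower limit. *)
apply: nneseries_le_limn_einf => // M.
apply: (@le_trans _ _ (\sum_(n <= t < M) a t)%E).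
  have [nM|Mn] := leqP n M.
    rewrite [leLHS](big_cat_nat (leq0n n) nM)/= [X in (X + _)%E]big_nat_cond.
    rewrite [X in (X + _)%E]big1 ?add0e//.
    by move=> t /andP[/andP[_ tn] _]; rewrite /a leqNgt tn.
  rewrite [leRHS]big_geq ?(ltnW Mn)// big_nat_cond big1//.
  by move=> t /andP[/andP[_ tM] _]; rewrite /a leqNgt (ltn_trans tM Mn).
have -> : (\sum_(n <= t < M) (k t * err t)%:E)%E = (\sum_(n <= t < M) err t * k t)%:E.
  by rewrite -sumEFin; apply: eq_bigr => t _; rewrite mulrC.
apply: le_trans (integral_weighted_ell_le M).
rewrite big_nat_cond [leRHS]big_nat_cond; apply: lee_sum.
by move=> t /andP[/andP[nt _] _]; rewrite /a nt.
Qed.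

End accuracy.

Theorem theorem24 (R : realType) (N n : nat) (hNn : (1 < N * n)%N)
  (k : nat -> R) (eps alpha : R) (heps : 0 < eps) (halpha : 0 < alpha)
  (X : nat -> vec R N) (hX : database_stream n X)
  (dS : measure_display) (S : measurableType dS) (F : query_stream R N S)
  (d : measure_display) (Om : measurableType d) (P : probability Om R)
  (U : Om -> S) (hU : measurable_fun [set: Om] U)
  (W : draw -> nat -> nat -> bool -> {RV P >-> R})
  (hlaw : forall (q : draw) (t m : nat) (c : bool), (n <= t)%N ->
     laplace_law (draw_scale (xi N n eps alpha t) q) (W q t m c))
  (hind : mutually_independent P (sources U W))
  (hF : forall (omega : Om) (t : nat), (n <= t)%N ->
     (\sum_(n <= tau < t.+1)
         ell n eps alpha X F (U omega) (noise_of W omega) tau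
       <= (\sum_(n <= tau < t.+1) k tau)%:E)%E) :
  let failure :=
    [set omega | ~ all_accurate n eps alpha X F (U omega) (noise_of W omega)] in
  measurable failure /\
  (P failure <=
     (expR (- (alpha * xi N n eps alpha n / 24)))%:E
     + 3%:E * series_from n
         (fun t => (k t * expR (- (alpha * xi N n eps alpha t / 24)))%R))%E.
Proof.
split; first exact: measurable_failure.
exact: measure_failure.
Qed.
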